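(* Let $N=\langle x,y\rangle\le S_{32}$, let $\mathcal P = 2^{\star 32}:N$ be the associated progenitor with symmetric generators $t_1,\dots,t_{32}$, and let $\pi = xy^{-2}xy$, $\tau = x^5y^3$ in $N$ (all as specified in the context). Let $$\mathcal G=\frac{\mathcal P}{(\tau t_1)^3,\ (\pi t_2)^6}$$ be the quotient of $\mathcal P$ by the normal closure of $\{(\tau t_1)^3,(\pi t_2)^6\}$, a group which is equally given (with $t=t_1$) by the presentation $$\langle x,y,t\mid x^{10}, y^6, (xy^{-2}x)^2, (xy^2x^2)^2, (y^{-1}x^{-1})^5, (xy^2x^{-1}y^{-1})^2, x^{-1}y^{-1}x^5yx^{-4}, yx^{-2}y^{-1}x^3yxy^3x^{-1}, t^2, (t,x^2), (t,y^2), (xy^{-2}xyt^x)^6, (xt)^5\rangle.$$ Then $\mathcal G$ is isomorphic to the Janko group $J_2$.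
   Context: $J_2$ is the second Janko group, the sporadic simple group of order $604800$. Permutations act on the right, so $gh$ means first $g$, then $h$; $a^b=b^{-1}ab$; $(a,b)$ denotes the commutator of $a$ and $b$. Let $x,y\in S_{32}$ be $x=(1,2)(3,5,7,11,17,4,6,9,14,22)(8,13,20,29,23,10,16,25,30,18)(12,19,28,32,26,15,24,27,31,21)$, $y=(1,3)(2,4)(5,8)(6,10)(7,12,17,27,14,23)(9,15,22,28,11,18)(13,21,24,30,32,20)(16,26,19,29,31,25)$, and $N=\langle x,y\rangle$, which is isomorphic to $2^{1+4}:A_5$ (order $1920$; extraspecial $2^{1+4}$ extended by $A_5$). $2^{\star 32}=\langle t_1,\dots,t_{32}\mid t_i^2=1\rangle$ is the free product of 32 copies of $C_2$, and $\mathcal P=2^{\star 32}:N$ is the semidirect product in which $n^{-1}t_in=t_{i^n}$ for $n\in N$. Explicitly, $\pi=(1,3,12,16,7)(2,4,15,13,9)(5,28,14,23,26)(6,27,11,18,21)(8,19,30,20,22)(10,24,29,25,17)$, $\tau=(1,4)(2,3)(5,10)(6,8)(7,28)(9,27)(11,12)(13,29)(14,15)(16,30)(17,18)(19,20)(21,31)(22,23)(24,25)(26,32)$. *)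

(* Defs.v *)
From HB Require Import structures.
From mathcomp Require Import all_boot all_fingroup.
From mathcomp Require Import generic_quotient boolp.

Set Implicit Arguments.
Unset Strict Implicit.
Unset Printing Implicit Defensive.

Local Open Scope group_scope.
Local Open Scope quotient_scope.

Definition isomorphic (G H : groupType) : Prop :=
  exists f : {multiplicative G -> H}, bijective f.

Section NormalClosure.
Variable G : groupType.

Definition normal_subgroup (K : G -> Prop) : Prop :=
  [/\ K 1, forall g h, K g -> K h -> K (g * h),
      forall g, K g -> K g^-1 & forall g h, K g -> K (g ^ h)].

Definition normal_closure (rs : seq G) (g : G) : Prop :=
  forall K : G -> Prop,
    normal_subgroup K -> (forall r, r \in rs -> K r) -> K g.

Variable rs : seq G.

Lemma normal_closureP : normal_subgroup (normal_closure rs).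
Proof.
split=> [K [] // | g h Kg Kh K nK rK | g Kg K nK rK | g h Kg K nK rK].
- by case: (nK) => _ KM _ _; exact: KM (Kg K nK rK) (Kh K nK rK).
- by case: (nK) => _ _ KV _; exact: KV (Kg K nK rK).
- by case: (nK) => _ _ _ KJ; exact: KJ (Kg K nK rK).
Qed.

Lemma normal_closure_gen r : r \in rs -> normal_closure rs r.
Proof. by move=> rrs K _; apply. Qed.

Definition ncl_rel : rel G := fun g h => `[< normal_closure rs (g^-1 * h) >].

Lemma ncl_rel_refl : reflexive ncl_rel.
Proof.
by case: normal_closureP => K1 _ _ _ g; apply/asboolP; rewrite mulVg.
Qed.

Lemma ncl_rel_sym : symmetric ncl_rel.
Proof.
case: normal_closureP => _ _ KV _.
have sub g h : ncl_rel g h -> ncl_rel h g.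
  by move/asboolP/KV; rewrite invgM invgK => Kgh; apply/asboolP.
by move=> g h; apply/idP/idP; apply: sub.
Qed.

Lemma ncl_rel_trans : transitive ncl_rel.
Proof.
case: normal_closureP => _ KM _ _ h g k /asboolP Kgh /asboolP Khk.
by apply/asboolP; have := KM _ _ Kgh Khk; rewrite mulgA mulgK.
Qed.

Canonical ncl_equiv :=
  EquivRel ncl_rel ncl_rel_refl ncl_rel_sym ncl_rel_trans.

Definition quot_ncl : Type := {eq_quot ncl_equiv}.
HB.instance Definition _ := Choice.on quot_ncl.
HB.instance Definition _ := EqQuotient.on quot_ncl.

Definition quot_proj (g : G) : quot_ncl := \pi_quot_ncl g.

Lemma quot_projP g h :
  quot_proj g = quot_proj h <-> normal_closure rs (g^-1 * h).
Proof. by split=> [/eqmodP/asboolP | K]; last by apply/eqmodP/asboolP. Qed.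

Lemma quot_repr (q : quot_ncl) : quot_proj (repr q) = q.
Proof. exact: reprK. Qed.

Definition quot_one : quot_ncl := quot_proj 1.
Definition quot_mul (p q : quot_ncl) : quot_ncl :=
  quot_proj (repr p * repr q).
Definition quot_inv (q : quot_ncl) : quot_ncl := quot_proj (repr q)^-1.

Lemma quot_mulE g h :
  quot_mul (quot_proj g) (quot_proj h) = quot_proj (g * h).
Proof.
apply/quot_projP.
set g' := repr _; set h' := repr _.
have Kg : normal_closure rs (g'^-1 * g) by apply/quot_projP/quot_repr.
have Kh : normal_closure rs (h'^-1 * h) by apply/quot_projP/quot_repr.
case: normal_closureP => _ KM _ KJ.
have -> : (g' * h')^-1 * (g * h) = (g'^-1 * g) ^ h' * (h'^-1 * h).
  by rewrite /conjg invgM !mulgA mulgK.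
by apply: KM => //; apply: KJ.
Qed.

Lemma quot_invE g : quot_inv (quot_proj g) = quot_proj g^-1.
Proof.
apply/quot_projP; set g' := repr _.
have Kg : normal_closure rs (g'^-1 * g) by apply/quot_projP/quot_repr.
case: normal_closureP => _ _ KV KJ.
have -> : g'^-1^-1 * g^-1 = ((g'^-1 * g)^-1) ^ g'^-1.
  by rewrite /conjg invgM !invgK -!mulgA mulgV mulg1.
exact: KJ (KV _ Kg).
Qed.

Fact quot_mulA : associative quot_mul.
Proof.
move=> p q r; rewrite -(quot_repr p) -(quot_repr q) -(quot_repr r).
by rewrite !quot_mulE mulgA.
Qed.

Fact quot_mul1 : left_id quot_one quot_mul.
Proof. by move=> q; rewrite -(quot_repr q) quot_mulE mul1g. Qed.

Fact quot_mulr1 : right_id quot_one quot_mul.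
Proof. by move=> q; rewrite -(quot_repr q) quot_mulE mulg1. Qed.

Fact quot_mulV : left_inverse quot_one quot_inv quot_mul.
Proof. by move=> q; rewrite -(quot_repr q) quot_invE quot_mulE mulVg. Qed.

Fact quot_mulrV : right_inverse quot_one quot_inv quot_mul.
Proof. by move=> q; rewrite -(quot_repr q) quot_invE quot_mulE mulgV. Qed.

HB.instance Definition _ := isGroup.Build quot_ncl
  quot_mulA quot_mul1 quot_mulr1 quot_mulV quot_mulrV.

Fact quot_projM : {morph quot_proj : g h / g * h}.
Proof. by move=> g h; rewrite -quot_mulE. Qed.
HB.instance Definition _ :=
  isMultiplicative.Build G quot_ncl quot_proj quot_projM.

(* The map induced by [f]; meaningful when the morphism [f] kills [rs]. *)
Definition quot_lift (H : groupType) (f : G -> H) (q : quot_ncl) : H :=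
  f (repr q).

Lemma quot_liftE (H : groupType) (f : G -> H) :
    {morph f : g h / g * h} -> (forall r, r \in rs -> f r = 1) ->
  forall g, quot_lift f (quot_proj g) = f g.
Proof.
move=> fM fr g; rewrite /quot_lift; set g' := repr _.
have f1 : f 1 = 1 by apply: (mulgI (f 1)); rewrite -fM !mulg1.
have fV h : f h^-1 = (f h)^-1 by apply: (mulgI (f h)); rewrite -fM !mulgV.
have Kg : normal_closure rs (g'^-1 * g) by apply/quot_projP/quot_repr.
have: f (g'^-1 * g) = 1.
  apply: (Kg (fun h => f h = 1)) => //; split=> //.
  - by move=> h k fh fk; rewrite fM fh fk mulg1.
  - by move=> h fh; rewrite fV fh invg1.
  by move=> h k fh; rewrite /conjg !fM fh mul1g -fM mulVg.
by rewrite fM fV => /(canRL (mulKVg _)); rewrite mulg1.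
Qed.

Lemma quot_liftM (H : groupType) (f : G -> H) :
    {morph f : g h / g * h} -> (forall r, r \in rs -> f r = 1) ->
  {morph quot_lift f : p q / p * q}.
Proof.
move=> fM fr p q; rewrite -(quot_repr p) -(quot_repr q) -quot_projM.
by rewrite !quot_liftE.
Qed.

End NormalClosure.

Section FreeGroup.
Variable I : choiceType.

(* The letter (i, false) stands for the generator i, (i, true) for i^-1. *)
Definition letter : Type := (I * bool)%type.
Definition letterV (l : letter) : letter := (l.1, ~~ l.2).

Inductive word_eq : seq letter -> seq letter -> Prop :=
| word_eq_refl u : word_eq u u
| word_eq_sym u v : word_eq u v -> word_eq v u
| word_eq_trans u v w : word_eq u v -> word_eq v w -> word_eq u w
| word_eq_cancel u l v : word_eq (u ++ [:: l, letterV l & v]) (u ++ v).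

Definition word_rel : rel (seq letter) := fun u v => `[< word_eq u v >].

Lemma word_rel_refl : reflexive word_rel.
Proof. by move=> u; apply/asboolP/word_eq_refl. Qed.

Lemma word_rel_sym : symmetric word_rel.
Proof.
by move=> u v; apply/asboolP/asboolP => uv; apply: word_eq_sym.
Qed.

Lemma word_rel_trans : transitive word_rel.
Proof.
move=> v u w /asboolP uv /asboolP vw.
by apply/asboolP; apply: word_eq_trans uv vw.
Qed.

Canonical word_equiv :=
  EquivRel word_rel word_rel_refl word_rel_sym word_rel_trans.

Definition free_group : Type := {eq_quot word_equiv}.
HB.instance Definition _ := Choice.on free_group.
HB.instance Definition _ := EqQuotient.on free_group.

Definition free_class (u : seq letter) : free_group := \pi_free_group u.

Lemma free_classP u v : free_class u = free_class v <-> word_eq u v.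
Proof. by split=> [/eqmodP/asboolP | uv]; last by apply/eqmodP/asboolP. Qed.

Lemma free_repr (a : free_group) : free_class (repr a) = a.
Proof. exact: reprK. Qed.

Lemma word_eq_cat u u' v v' :
  word_eq u u' -> word_eq v v' -> word_eq (u ++ v) (u' ++ v').
Proof.
move=> uu' vv'; apply: (@word_eq_trans _ (u' ++ v)).
  elim: uu' => [w | w1 w2 _ | w1 w2 w3 _ IH1 _ | w1 l w2].
  - exact: word_eq_refl.
  - exact: word_eq_sym.
  - exact: word_eq_trans IH1.
  by rewrite -!catA; apply: word_eq_cancel.
elim: vv' => [w | w1 w2 _ | w1 w2 w3 _ IH1 _ | w1 l w2].
- exact: word_eq_refl.
- exact: word_eq_sym.
- exact: word_eq_trans IH1.
by rewrite !catA -(catA _ w1) catA; apply: word_eq_cancel.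
Qed.

Definition wordV (u : seq letter) := rev (map letterV u).

Lemma letterVK : involutive letterV.
Proof. by case=> i b; rewrite /letterV /= negbK. Qed.

Lemma word_eqV u v : word_eq u v -> word_eq (wordV u) (wordV v).
Proof.
elim=> [w | w1 w2 _ | w1 w2 w3 _ IH1 _ | w1 l w2].
- exact: word_eq_refl.
- exact: word_eq_sym.
- exact: word_eq_trans IH1.
rewrite /wordV !map_cat !rev_cat /= !rev_cons -!cats1 -!catA /=.
by have := word_eq_cancel (rev (map letterV w2)) (letterV (letterV l))
             (rev (map letterV w1)); rewrite letterVK.
Qed.

Lemma word_eqVl u : word_eq (wordV u ++ u) [::].
Proof.
elim: u => [|l u IHu]; first exact: word_eq_refl.
rewrite /wordV /= rev_cons -cats1 -catA /=.
apply: word_eq_trans IHu.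
by have := word_eq_cancel (wordV u) (letterV l) u; rewrite letterVK.
Qed.

Lemma wordVK : involutive wordV.
Proof. by move=> u; rewrite /wordV map_rev revK mapK //; apply: letterVK. Qed.

Definition free_one : free_group := free_class [::].
Definition free_mul (a b : free_group) : free_group :=
  free_class (repr a ++ repr b).
Definition free_inv (a : free_group) : free_group := free_class (wordV (repr a)).

Lemma free_mulE u v : free_mul (free_class u) (free_class v) = free_class (u ++ v).
Proof. by apply/free_classP/word_eq_cat; apply/free_classP/free_repr. Qed.

Lemma free_invE u : free_inv (free_class u) = free_class (wordV u).
Proof. by apply/free_classP/word_eqV/free_classP/free_repr. Qed.

Fact free_mulA : associative free_mul.
Proof.
move=> a b c; rewrite -(free_repr a) -(free_repr b) -(free_repr c).
by rewrite !free_mulE catA.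
Qed.

Fact free_mul1 : left_id free_one free_mul.
Proof. by move=> a; rewrite -(free_repr a) free_mulE. Qed.

Fact free_mulr1 : right_id free_one free_mul.
Proof. by move=> a; rewrite -(free_repr a) free_mulE cats0. Qed.

Fact free_mulV : left_inverse free_one free_inv free_mul.
Proof.
move=> a; rewrite -(free_repr a) free_invE free_mulE.
exact/free_classP/word_eqVl.
Qed.

Fact free_mulrV : right_inverse free_one free_inv free_mul.
Proof.
move=> a; rewrite -(free_repr a) free_invE free_mulE.
by apply/free_classP; rewrite -{1}(wordVK (repr a)); apply: word_eqVl.
Qed.

HB.instance Definition _ := isGroup.Build free_group
  free_mulA free_mul1 free_mulr1 free_mulV free_mulrV.

Lemma free_class_cat u v : free_class (u ++ v) = free_class u * free_class v.
Proof. by rewrite -free_mulE. Qed.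

Lemma free_classV u : free_class (wordV u) = (free_class u)^-1.
Proof. by rewrite -free_invE. Qed.

Definition free_gen (i : I) : free_group := free_class [:: (i, false)].

Definition word_eval (G : groupType) (f : I -> G) (u : seq letter) : G :=
  \prod_(l <- u) (if l.2 then (f l.1)^-1 else f l.1).

Lemma word_eval_eq (G : groupType) (f : I -> G) u v :
  word_eq u v -> word_eval f u = word_eval f v.
Proof.
elim=> [|w1 w2 _ -> | w1 w2 w3 _ -> _ -> | w1 [i b] w2] //.
rewrite /word_eval !big_cat !big_cons /=.
by case: b; rewrite /= ?mulKg ?mulKVg.
Qed.

Definition free_lift (G : groupType) (f : I -> G) (a : free_group) : G :=
  word_eval f (repr a).

Lemma free_liftE (G : groupType) (f : I -> G) u :
  free_lift f (free_class u) = word_eval f u.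
Proof. by apply/word_eval_eq/free_classP/free_repr. Qed.

Lemma free_liftM (G : groupType) (f : I -> G) :
  {morph free_lift f : a b / a * b}.
Proof.
move=> a b; rewrite -(free_repr a) -(free_repr b).
by rewrite -free_class_cat !free_liftE; exact: big_cat.
Qed.

Lemma free_lift_gen (G : groupType) (f : I -> G) i :
  free_lift f (free_gen i) = f i.
Proof. by rewrite free_liftE /word_eval big_seq1. Qed.

End FreeGroup.

Definition presented (I : choiceType) (rs : seq (free_group I)) : groupType :=
  quot_ncl rs.

Definition pres_gen (I : choiceType) (rs : seq (free_group I)) (i : I) :
  presented rs := quot_proj rs (free_gen i).

Lemma pres_ext (I : choiceType) (rs : seq (free_group I)) (G : groupType)
    (f g : presented rs -> G) :
    {morph f : a b / a * b} -> {morph g : a b / a * b} ->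
  (forall i, f (pres_gen rs i) = g (pres_gen rs i)) -> f =1 g.
Proof.
move=> fM gM fg q; rewrite -(quot_repr q) -(free_repr (repr q)).
have m1 (h : presented rs -> G) : {morph h : a b / a * b} -> h 1 = 1.
  by move=> hM; apply: (mulgI (h 1)); rewrite -hM !mulg1.
have mV (h : presented rs -> G) : {morph h : a b / a * b} ->
    forall a, h a^-1 = (h a)^-1.
  by move=> hM a; apply: (mulgI (h a)); rewrite -hM !mulgV (m1 h).
elim: (repr (repr q)) => [|[i b] u IHu]; first by rewrite (m1 f) ?(m1 g).
rewrite -cat1s free_class_cat quot_projM fM gM {}IHu.
congr (_ * _); case: b; last exact: fg.
have -> : free_class [:: (i, true)] = (free_gen i)^-1.
  by rewrite -free_classV.
have -> : quot_proj rs (free_gen i)^-1 = (pres_gen rs i)^-1.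
  by rewrite -quot_invE.
by rewrite (mV f) // (mV g) // fg.
Qed.

(* A right action of K on H by automorphisms. *)
Record aut_action (H K : groupType) := AutAction {
  aut_act :> H -> K -> H;
  aut_actM : forall k, {morph aut_act^~ k : a b / a * b};
  aut_act1 : forall a, aut_act a 1 = a;
  aut_act_comp : forall a k l, aut_act a (k * l) = aut_act (aut_act a k) l
}.

Section Semidirect.
Variables (H K : groupType) (to : aut_action H K).

(* The pair (k, a) stands for the product k * a, and k^-1 * a * k = to a k. *)
Definition semidirect : Type := let _ := to in (K * H)%type.
HB.instance Definition _ := Choice.copy semidirect (K * H)%type.

Definition sd_one : semidirect := (1, 1).
Definition sd_mul (p q : semidirect) : semidirect :=
  (p.1 * q.1, to p.2 q.1 * q.2).
Definition sd_inv (p : semidirect) : semidirect :=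
  (p.1^-1, to p.2^-1 p.1^-1).

Lemma aut_act_one k : to 1 k = 1.
Proof. by apply: (mulgI (to 1 k)); rewrite -aut_actM !mulg1. Qed.

Fact sd_mulA : associative sd_mul.
Proof.
by move=> p q r; rewrite /sd_mul /= aut_actM aut_act_comp !mulgA.
Qed.

Fact sd_mul1 : left_id sd_one sd_mul.
Proof. by case=> k a; rewrite /sd_mul /= aut_act_one !mul1g. Qed.

Fact sd_mulr1 : right_id sd_one sd_mul.
Proof. by case=> k a; rewrite /sd_mul /= aut_act1 !mulg1. Qed.

Fact sd_mulV : left_inverse sd_one sd_inv sd_mul.
Proof.
case=> k a.
by rewrite /sd_mul /= -aut_act_comp !mulVg aut_act1 mulVg.
Qed.

Fact sd_mulrV : right_inverse sd_one sd_inv sd_mul.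
Proof. by case=> k a; rewrite /sd_mul /= -aut_actM !mulgV aut_act_one. Qed.

HB.instance Definition _ := isGroup.Build semidirect
  sd_mulA sd_mul1 sd_mulr1 sd_mulV sd_mulrV.

Definition sd_inl (k : K) : semidirect := (k, 1).
Definition sd_inr (a : H) : semidirect := (1, a).

Lemma sd_conj a k : sd_inr a ^ sd_inl k = sd_inr (to a k).
Proof.
rewrite /conjg; apply: (mulgI (sd_inl k)); rewrite mulKVg.
by congr pair; rewrite /= ?mul1g ?mulg1 // aut_act_one mul1g.
Qed.

End Semidirect.

Section Progenitor.
Variable T : finType.

Definition star_rels : seq (free_group T) :=
  [seq free_gen i ^+ 2 | i <- enum T].

(* The free product of copies <t_i> of C_2 indexed by T. *)
Definition star : groupType := presented star_rels.

Definition star_gen (i : T) : star := pres_gen star_rels i.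

Variable N : {group {perm T}}.

(* t_i is mapped to t_(i^n). *)
Definition star_act (a : star) (n : [subg N]) : star :=
  quot_lift (free_lift (fun i => star_gen (sgval n i))) a.

Lemma star_gen2 i : star_gen i ^+ 2 = 1.
Proof.
rewrite expgS expg1 /star_gen /pres_gen -quot_projM.
apply/esym/quot_projP; rewrite invg1 mul1g; apply: normal_closure_gen.
by apply/mapP; exists i; rewrite ?mem_enum.
Qed.

Lemma star_act_rel (n : [subg N]) r : r \in star_rels ->
  free_lift (fun i => star_gen (sgval n i)) r = 1.
Proof.
case/mapP=> i _ ->; rewrite expgS expg1 free_liftM free_lift_gen.
exact: star_gen2.
Qed.

Fact star_actM (n : [subg N]) : {morph star_act^~ n : a b / a * b}.
Proof.
by apply: quot_liftM; [apply: free_liftM | apply: star_act_rel].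
Qed.

Lemma star_act_gen i (n : [subg N]) :
  star_act (star_gen i) n = star_gen (sgval n i).
Proof.
rewrite /star_act quot_liftE ?free_lift_gen //; first exact: free_liftM.
exact: star_act_rel.
Qed.

Fact star_act1 a : star_act a 1 = a.
Proof.
move: a; apply: pres_ext => // [|i]; first exact: star_actM.
by rewrite star_act_gen perm1.
Qed.

Fact star_act_comp a k l : star_act a (k * l) = star_act (star_act a k) l.
Proof.
move: a; apply: (@pres_ext _ _ _ (star_act^~ (k * l))
  (fun a => star_act (star_act a k) l)) => [|a b|i].
- exact: star_actM.
- by rewrite !star_actM.
by rewrite !star_act_gen permM.
Qed.

Definition star_action : aut_action star (subg_of N) :=
  AutAction star_actM star_act1 star_act_comp.

Definition progenitor : groupType := semidirect star_action.

(* [prog_perm n] is meant for n in N: [subg N n] is n for such n. *)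
Definition prog_perm (n : {perm T}) : progenitor :=
  sd_inl star_action (subg N n).
Definition prog_gen (i : T) : progenitor := sd_inr star_action (star_gen i).

Lemma prog_genJ i n : n \in N ->
  prog_gen i ^ prog_perm n = prog_gen (n i).
Proof.
move=> Nn; rewrite sd_conj; congr (sd_inr _ _).
by rewrite -[LHS]/(star_act _ _) star_act_gen subgK.
Qed.

End Progenitor.

(* The points 1, ..., n + 1 of cycle notation are the ordinals 0, ..., n. *)
Definition point (n k : nat) : 'I_n.+1 := inord k.-1.

(* Permutations act on the right, so (a, b, ..., z) = (a, b) ... (a, z). *)
Definition cycle_perm (T : finType) (c : seq T) : {perm T} :=
  if c is a :: s then \prod_(b <- s) tperm a b else 1.

Lemma cycle_permE (T : finType) (c : seq T) x :
  uniq c -> cycle_perm c x = next c x.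
Proof.
case: c => [|a s]; first by rewrite perm1.
elim: s x => [|b s IHs] x; first by rewrite /= big_nil perm1; case: eqP.
rewrite /= inE negb_or -!andbA => /and4P[ab as_ bs Us].
have Uas : uniq (a :: s) by rewrite /= as_.
rewrite big_cons permM; move: (IHs) => /= {}IHs.
case: tpermP => [->|->|/eqP/negPf xa /eqP/negPf xb]; rewrite IHs //.
- rewrite eqxx -[next_at _ _ _ _]/(next (a :: s) b) next_nth.
  by rewrite inE eq_sym (negPf ab) (negPf bs).
- by rewrite eq_sym (negPf ab); case: (s) => [|? ?] /=; rewrite !eqxx.
by rewrite xa; case: (s) => [|? ?] /=; rewrite ?xa ?xb.
Qed.

Definition perm_of_cycles (n : nat) (cs : seq (seq nat)) : 'S_n.+1 :=
  \prod_(c <- cs) cycle_perm (map (point n) c).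

Definition x32 : 'S_32 := perm_of_cycles 31 [::
    [:: 1; 2]; [:: 3; 5; 7; 11; 17; 4; 6; 9; 14; 22];
    [:: 8; 13; 20; 29; 23; 10; 16; 25; 30; 18];
    [:: 12; 19; 28; 32; 26; 15; 24; 27; 31; 21]]%N.

Definition y32 : 'S_32 := perm_of_cycles 31 [::
    [:: 1; 3]; [:: 2; 4]; [:: 5; 8]; [:: 6; 10]; [:: 7; 12; 17; 27; 14; 23];
    [:: 9; 15; 22; 28; 11; 18]; [:: 13; 21; 24; 30; 32; 20];
    [:: 16; 26; 19; 29; 31; 25]]%N.

Definition N32 : {group 'S_32} := <<[set x32; y32]>>%G.

Definition prog32 : groupType := progenitor N32.
Definition t32 (k : nat) : prog32 := prog_gen N32 (point 31 k).

Definition pi32 : 'S_32 := x32 * y32 ^- 2 * x32 * y32.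
Definition tau32 : 'S_32 := x32 ^+ 5 * y32 ^+ 3.

Lemma x32_N : x32 \in N32.
Proof. by rewrite mem_gen // !inE eqxx. Qed.

Lemma y32_N : y32 \in N32.
Proof. by rewrite mem_gen // !inE eqxx orbT. Qed.

Lemma pi32_N : pi32 \in N32.
Proof. by rewrite !groupM ?groupV ?groupX ?x32_N ?y32_N. Qed.

Lemma tau32_N : tau32 \in N32.
Proof. by rewrite groupM ?groupX ?x32_N ?y32_N. Qed.

Definition G_rels : seq prog32 :=
  [:: (prog_perm N32 tau32 * t32 1) ^+ 3;
      (prog_perm N32 pi32 * t32 2) ^+ 6].

Definition calG : groupType := quot_ncl G_rels.

Definition G_x : calG := quot_proj G_rels (prog_perm N32 x32).
Definition G_y : calG := quot_proj G_rels (prog_perm N32 y32).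
Definition G_t1 : calG := quot_proj G_rels (t32 1).

Section Presentation.
Let x : free_group 'I_3 := free_gen (point 2 1).
Let y : free_group 'I_3 := free_gen (point 2 2).
Let t : free_group 'I_3 := free_gen (point 2 3).

Definition pres_rels : seq (free_group 'I_3) :=
  [:: x ^+ 10; y ^+ 6; (x * y ^- 2 * x) ^+ 2; (x * y ^+ 2 * x ^+ 2) ^+ 2;
      (y^-1 * x^-1) ^+ 5; (x * y ^+ 2 * x^-1 * y^-1) ^+ 2;
      x^-1 * y^-1 * x ^+ 5 * y * x ^- 4;
      y * x ^- 2 * y^-1 * x ^+ 3 * y * x * y ^+ 3 * x^-1;
      t ^+ 2; [~ t, x ^+ 2]; [~ t, y ^+ 2];
      (x * y ^- 2 * x * y * t ^ x) ^+ 6; (x * t) ^+ 5].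
End Presentation.

Definition presG : groupType := presented pres_rels.

Definition presG_x : presG := pres_gen pres_rels (point 2 1).
Definition presG_y : presG := pres_gen pres_rels (point 2 2).
Definition presG_t : presG := pres_gen pres_rels (point 2 3).

(* J_2 as the rank 3 group of degree 100 of Hall and Wales, generated by the
   standard generators of the ATLAS of Group Representations (a in class 2B,
   b in class 3B, ab of order 7, [a, b] of order 12). *)
Definition J2a : 'S_100 := perm_of_cycles 99 [::
    [:: 1; 84]; [:: 2; 20]; [:: 3; 48]; [:: 4; 56]; [:: 5; 82]; [:: 6; 67];
    [:: 7; 55]; [:: 8; 41]; [:: 9; 35]; [:: 10; 40]; [:: 11; 78];
    [:: 12; 100]; [:: 13; 49]; [:: 14; 37]; [:: 15; 94]; [:: 16; 76];
    [:: 17; 19]; [:: 18; 44]; [:: 21; 34]; [:: 22; 85]; [:: 23; 92];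
    [:: 24; 57]; [:: 25; 75]; [:: 26; 28]; [:: 27; 64]; [:: 29; 90];
    [:: 30; 97]; [:: 31; 38]; [:: 32; 68]; [:: 33; 69]; [:: 36; 53];
    [:: 39; 61]; [:: 42; 73]; [:: 43; 91]; [:: 45; 86]; [:: 46; 81];
    [:: 47; 89]; [:: 50; 93]; [:: 51; 96]; [:: 52; 72]; [:: 54; 74];
    [:: 58; 99]; [:: 59; 95]; [:: 60; 63]; [:: 62; 83]; [:: 65; 70];
    [:: 66; 88]; [:: 71; 87]; [:: 77; 98]; [:: 79; 80]]%N.

Definition J2b : 'S_100 := perm_of_cycles 99 [::
    [:: 1; 80; 22]; [:: 2; 9; 11]; [:: 3; 53; 87]; [:: 4; 23; 78];
    [:: 5; 51; 18]; [:: 6; 37; 24]; [:: 8; 27; 60]; [:: 10; 62; 47];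
    [:: 12; 65; 31]; [:: 13; 64; 19]; [:: 14; 61; 52]; [:: 15; 98; 25];
    [:: 16; 73; 32]; [:: 17; 39; 33]; [:: 20; 97; 58]; [:: 21; 96; 67];
    [:: 26; 93; 99]; [:: 28; 57; 35]; [:: 29; 71; 55]; [:: 30; 69; 45];
    [:: 34; 86; 82]; [:: 38; 59; 94]; [:: 40; 43; 91]; [:: 42; 68; 44];
    [:: 46; 85; 89]; [:: 48; 76; 90]; [:: 49; 92; 77]; [:: 50; 66; 88];
    [:: 54; 95; 56]; [:: 63; 74; 72]; [:: 70; 81; 75]; [:: 79; 100; 83]]%N.

Definition J2 : {group 'S_100} := <<[set J2a; J2b]>>%G.

(* Main.v *)
Require Import Defs.
From Stdlib Require Import PArith NArith FMapPositive.
From HB Require Import structures.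
From mathcomp Require Import all_boot all_fingroup boolp.

(* Both presG and calG are generated by elements x, y, t satisfying the eight
   relators of N and four relators involving t; they differ in the last relator,
   (x t)^5 or (x^5 y^3 t)^3. A coset enumeration over <x> shows that the
   relators of N bound <x, y> by 10 * 192 elements, and in each of the two
   groups an enumeration over <x, y> yields 315 cosets, whence the bound 604800
   for the order. Words in the generators of J2 satisfying all the relators give
   morphisms from both groups onto J2, and a stabiliser chain shows that J2 has
   at least 100 * 63 * 12 * 8 = 604800 elements; so both are isomorphisms. The
   morphism from calG exists because the relators of N present N32. *)

Set Implicit Arguments.
Unset Strict Implicit.
Unset Printing Implicit Defensive.

Local Open Scope group_scope.

(** * Words and relators *)

(** Neither of the relators $(xt)^5$ and $(x^5y^3t)^3$ is derived from the other by manipulating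
    words. One triple in $J_2$ satisfies both, so the isomorphisms from [presG] and [calG] send
    their named generators to the same elements, and composing the first with the inverse of the
    second matches these generators. The abstract groups are not known to be finite until the end.
    An enumeration therefore works in an arbitrary group, with the subgroup given as a predicate,
    and delivers a list that covers the group. Upper bounds for the abstract groups and lower bounds
    for the permutation groups are enough, so cosets are not shown to be distinct, nor words to
    generate a full stabiliser. The lists of steps and words are certificates: the procedure that
    replays the steps is sound for every list, and a wrong list could only make a computed check
    fail. Since elements of ['S_n] are unsuited to evaluation, the checks on permutations run on
    lists of images. *)

(* sX and sY are the inverses of sx and sy, while st is its own inverse. *)
Inductive sym := sx | sX | sy | sY | st.

Scheme Equality for sym.

Lemma sym_eqP : Equality.axiom sym_beq.
Proof.
move=> s u; apply: (iffP idP); first exact: internal_sym_dec_bl.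
exact: internal_sym_dec_lb.
Qed.
HB.instance Definition _ := hasDecEq.Build sym sym_eqP.

Definition symV (s : sym) : sym :=
  match s with sx => sX | sX => sx | sy => sY | sY => sy | st => st end.

Definition symsV (w : seq sym) : seq sym := rev (map symV w).

(** Relators have two readings: [term_val] unfolds by conversion to the stated form of the relator,
    while [term_word] flattens it to the letters that are traced through coset tables and
    permutations. *)
Inductive term :=
  | Tx | Ty | Tt | Tmul of term & term | Tinv of term | Texp of term & nat.

Fixpoint term_word (e : term) : seq sym :=
  match e with
  | Tx => [:: sx]
  | Ty => [:: sy]
  | Tt => [:: st]
  | Tmul e1 e2 => term_word e1 ++ term_word e2
  | Tinv e1 => symsV (term_word e1)
  | Texp e1 n => iter n (cat (term_word e1)) [::]
  end.

Section Evaluation.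
Variables (G : groupType) (x y t : G).

Definition sym_val (s : sym) : G :=
  match s with sx => x | sX => x^-1 | sy => y | sY => y^-1 | st => t end.

Definition word_val (w : seq sym) : G :=
  foldr (fun s g => sym_val s * g) 1 w.

Fixpoint term_val (e : term) : G :=
  match e with
  | Tx => x
  | Ty => y
  | Tt => t
  | Tmul e1 e2 => term_val e1 * term_val e2
  | Tinv e1 => (term_val e1)^-1
  | Texp e1 n => term_val e1 ^+ n
  end.

Lemma word_val_cat u v : word_val (u ++ v) = word_val u * word_val v.
Proof. by elim: u => [|s u IHu] /=; rewrite ?mul1g // IHu mulgA. Qed.

Hypothesis t2 : t ^+ 2 = 1.

Lemma sym_valV s : sym_val (symV s) = (sym_val s)^-1.
Proof.
case: s; rewrite /= ?invgK //.
by apply: (mulgI t); rewrite mulgV -t2 expgS expg1.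
Qed.

Lemma word_valV w : word_val (symsV w) = (word_val w)^-1.
Proof.
elim: w => [|s w IHw]; first by rewrite invg1.
by rewrite /symsV /= rev_cons -cats1 word_val_cat IHw /= sym_valV mulg1 invgM.
Qed.

Lemma word_val_term e : word_val (term_word e) = term_val e.
Proof.
elim: e => //= [||| e1 <- e2 <- | e1 <- | e1 IHe n]; rewrite ?mulg1 //.
- exact: word_val_cat.
- exact: word_valV.
by elim: n => //= n IHn; rewrite word_val_cat IHe IHn expgS.
Qed.

End Evaluation.

Lemma morph_one (G H : groupType) (f : G -> H) :
  {morph f : a b / a * b} -> f 1 = 1.
Proof. by move=> fM; apply: (mulgI (f 1)); rewrite -fM !mulg1. Qed.

Lemma morph_inv (G H : groupType) (f : G -> H) a :
  {morph f : a b / a * b} -> f a^-1 = (f a)^-1.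
Proof.
move=> fM; apply: (mulgI (f a)); rewrite -fM !mulgV; exact: morph_one.
Qed.

Lemma term_val_morph (G H : groupType) (f : G -> H) x y t e :
    {morph f : a b / a * b} ->
  f (term_val x y t e) = term_val (f x) (f y) (f t) e.
Proof.
move=> fM; elim: e => //= [e1 <- e2 <- | e1 <- | e1 <- n] //.
  exact: morph_inv.
by elim: n => [|n IHn]; [exact: morph_one | rewrite !expgS fM IHn].
Qed.

(** * Coset enumeration *)

Module PM := PositiveMap.

(** The three lowest binary digits encode the letter, so one map keyed by positive numbers holds the
    whole table. *)
Definition entry (i : positive) (s : sym) : positive :=
  match s with
  | sx => i~0~0~0 | sX => i~0~0~1 | sy => i~0~1~0 | sY => i~0~1~1
  | st => i~1~0~0
  end.

Lemma entry_inj i s j u : entry i s = entry j u -> i = j /\ s = u.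
Proof. by case: s; case: u => //= -[]. Qed.

(* [tab] is a partial coset table; [dead] sends a coset found to coincide with
   an earlier one to the latter; the cosets in use are those below [next]. *)
Record state := State {
  next_coset : positive;
  tab : PM.t positive;
  dead : PM.t positive }.

(* The fuel only has to exceed the length of the chains of dead cosets. *)
Fixpoint chase (fuel : nat) (d : PM.t positive) (i : positive) : positive :=
  if fuel is fuel'.+1 then
    if PM.find i d is Some j then chase fuel' d j else i
  else i.

Definition live : PM.t positive -> positive -> positive := chase 99.
Arguments live : simpl never.

Definition lookup (E : state) (i : positive) (s : sym) : option positive :=
  omap (live (dead E)) (PM.find (entry i s) (tab E)).

Definition set_entry (E : state) i s j : state :=
  State (next_coset E) (PM.add (entry i s) j (tab E)) (dead E).

Definition set_edge (E : state) i s j : state :=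
  set_entry (set_entry E i s j) j (symV s) i.

Fixpoint follow (E : state) (i : positive) (w : seq sym) :=
  if w is s :: w' then
    if lookup E i s is Some j then follow E j w' else (i, w)
  else (i, w).

(** The row of the dead coset [b] is merged into that of [a]: two entries in the same column give a
    new coincidence, a single one is copied. Entries elsewhere that still point to [b] are left
    alone, since [lookup] redirects them. *)
Definition absorb (a b : positive) (Eq : state * seq (positive * positive)) s :=
  let: (E, q) := Eq in
  if PM.find (entry b s) (tab E) is Some k then
    if PM.find (entry a s) (tab E) is Some l then (E, (l, k) :: q)
    else (set_entry E a s k, q)
  else Eq.

Definition absorb_all (a b : positive) (E : state) q :=
  foldl (absorb a b) (E, q) [:: sx; sX; sy; sY; st].
Arguments absorb_all : simpl never.

Fixpoint coincide (fuel : nat) (E : state) (q : seq (positive * positive)) :=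
  if fuel is fuel'.+1 then
    if q is (a, b) :: q' then
      let a := live (dead E) a in let b := live (dead E) b in
      if Pos.eqb a b then coincide fuel' E q' else
      let: (a, b) := if Pos.ltb a b then (a, b) else (b, a) in
      let E := State (next_coset E) (tab E) (PM.add b a (dead E)) in
      let: (E, q') := absorb_all a b E q' in
      coincide fuel' E q'
    else E
  else E.

(** Exhausting the fuel merely leaves pending coincidences unprocessed, so its amount bears on
    completing the table and not on soundness. *)
Definition identify (E : state) (i j : positive) : state :=
  coincide 4999 E [:: (i, j)].
Arguments identify : simpl never.

(** The guard ignores a step that names a coset not yet introduced; this keeps arbitrary lists of
    steps sound. *)
Definition define (E : state) (i : positive) (s : sym) : state :=
  if Pos.ltb i (next_coset E) then
    let k := next_coset E in
    set_edge (State (Pos.succ k) (tab E) (dead E)) i s k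
  else E.

Definition scan (E : state) (k : positive) (w : seq sym) : state :=
  if Pos.ltb k (next_coset E) then
    let k := live (dead E) k in
    let: (i, w1) := follow E k w in
    let: (j, w2) := follow E k (symsV w1) in
    match w2 with
    | [::] => identify E i j
    | [:: s] => set_edge E i (symV s) j
    | _ => E
    end
  else E.

(* The step [32 k + r] defines a new coset from the coset [k] if [r < 5], and
   traces the relator number [r - 5] from the coset [k] otherwise. *)
Definition step (rels : seq (seq sym)) (E : state) (c : N) : state :=
  let k := if N.shiftr c 5 is Npos p then p else xH in
  match N.land c 31 with
  | 0 => define E k sx
  | 1 => define E k sX
  | 2 => define E k sy
  | 3 => define E k sY
  | 4 => define E k st
  | r => scan E k (nth [::] rels (N.to_nat r - 5))
  end%num.

Definition start (sub : seq sym) : state :=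
  foldl (fun E s => set_edge E 1%positive s 1%positive)
    (State 2 (PM.empty _) (PM.empty _)) sub.

(** This breadth-first search is not trusted: [closed_under] checks its result, and the proof
    generalises over it. *)
Fixpoint reachable (fuel : nat) (E : state) (gens : seq sym)
    (seen todo : seq positive) : seq positive :=
  match fuel, todo with
  | fuel'.+1, i :: todo' =>
      let new := foldl (fun l s =>
        if lookup E i s is Some j then
          if has (Pos.eqb j) (l ++ seen) then l else rcons l j
        else l) [::] gens in
      reachable fuel' E gens (new ++ seen) (todo' ++ new)
  | _, _ => seen
  end.

Definition closed_under (E : state) (gens : seq sym) (l : seq positive) : bool :=
  has (Pos.eqb 1) l && all (fun i => all (fun s =>
    if lookup E i s is Some j then has (Pos.eqb j) l else false) gens) l.

(* The index of the subgroup generated by [sub] in the group generated by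
   [gens], or 0 if the steps fail to complete the coset table. *)
Definition coset_count rels sub gens (steps : seq N) : nat :=
  let E := foldl (step rels) (start sub) steps in
  let l := reachable 999 E gens [:: 1%positive] [:: 1%positive] in
  if closed_under E gens l then size l else 0.

Lemma all_has_eqb (p : pred positive) l i :
  all p l -> has (Pos.eqb i) l -> p i.
Proof.
elim: l => //= j l IHl /andP[pj pl] /orP[/Pos.eqb_eq-> // | ].
exact: IHl.
Qed.

(** * Soundness of coset enumeration *)

Section Soundness.
Variables (G : groupType) (x y t : G).
Hypothesis t2 : t ^+ 2 = 1.
Variable K : G -> Prop.
Hypotheses (K1 : K 1) (KM : forall g h, K g -> K h -> K (g * h)).
Hypothesis KV : forall g, K g -> K g^-1.

Local Notation val := (sym_val x y t).

(** With [c] choosing representatives, this is the equality $Kc_ig=Kc_j$ of right cosets. The bounds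
    by [n] keep arrows valid when [c] is later changed at [n] to represent a new coset. *)
Definition arrow (c : positive -> G) (n i : positive) (g : G) (j : positive) :=
  [/\ (i < n)%positive, (j < n)%positive & K (c i * g * (c j)^-1)].

Lemma arrow_id c n i : (i < n)%positive -> arrow c n i 1 i.
Proof. by split; rewrite // mulg1 mulgV. Qed.

Lemma arrowM c n i g j h k :
  arrow c n i g j -> arrow c n j h k -> arrow c n i (g * h) k.
Proof.
case=> ? _ Kg [_ ? Kh]; split=> //.
by have := KM Kg Kh; rewrite !mulgA mulgKV.
Qed.

Lemma arrowV c n i g j : arrow c n i g j -> arrow c n j g^-1 i.
Proof. by case=> ? ? /KV; rewrite !invgM invgK mulgA; split. Qed.

Definition sound (c : positive -> G) (E : state) : Prop :=
  (forall i s j, PM.find (entry i s) (tab E) = Some j ->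
     arrow c (next_coset E) i (val s) j) /\
  (forall i j, PM.find i (dead E) = Some j -> arrow c (next_coset E) i 1 j).

Lemma sound_live c E i :
    sound c E -> (i < next_coset E)%positive ->
  arrow c (next_coset E) i 1 (live (dead E) i).
Proof.
case=> _ sD; rewrite /live; elim: 99 i => [|f IHf] i lt_i /=.
  exact: arrow_id.
case Ej: PM.find => [j|]; last exact: arrow_id.
have ij := sD _ _ Ej; rewrite -[1]mulg1; apply: (arrowM ij).
by apply: IHf; case: ij.
Qed.

Lemma sound_lookup c E i s j :
  sound c E -> lookup E i s = Some j -> arrow c (next_coset E) i (val s) j.
Proof.
move=> sE; rewrite /lookup; case Ek: PM.find => [k|] // [<-].
have ik := sE.1 _ _ _ Ek; rewrite -[val s]mulg1; apply: (arrowM ik).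
  by apply: sound_live; case: ik.
Qed.

Lemma sound_set_entry c E i s j :
    sound c E -> arrow c (next_coset E) i (val s) j ->
  sound c (set_entry E i s j).
Proof.
case=> sT sD ij; split=> //= k u l.
have [Ee|ne] := Pos.eq_dec (entry k u) (entry i s); last first.
  by rewrite PM.gso //; apply: sT.
by rewrite Ee PM.gss => -[<-]; have [-> ->] := entry_inj Ee.
Qed.

Lemma sound_set_edge c E i s j :
    sound c E -> arrow c (next_coset E) i (val s) j ->
  sound c (set_edge E i s j).
Proof.
move=> sE ij; apply: sound_set_entry; first exact: sound_set_entry.
by rewrite sym_valV //; apply: arrowV.
Qed.

Lemma sound_follow c E i w :
    sound c E -> (i < next_coset E)%positive ->
  exists2 u, w = u ++ (follow E i w).2 &
    arrow c (next_coset E) i (word_val x y t u) (follow E i w).1.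
Proof.
move=> sE; elim: w i => [|s w IHw] i lt_i /=.
  by exists [::] => //; apply: arrow_id.
case Ej: lookup => [j|]; last by exists [::] => //; apply: arrow_id.
have ij := sound_lookup sE Ej; have [_ lt_j _] := ij.
have [u Ew ju] := IHw j lt_j; exists (s :: u); first by rewrite [in LHS]Ew.
exact: (arrowM ij ju).
Qed.

Definition queue_sound c n (q : seq (positive * positive)) : Prop :=
  forall a b, List.In (a, b) q -> arrow c n a 1 b.

Lemma sound_absorb c n a b l E q :
    arrow c n a 1 b -> sound c E -> next_coset E = n -> queue_sound c n q ->
  let: (E1, q1) := foldl (absorb a b) (E, q) l in
  [/\ sound c E1, next_coset E1 = n & queue_sound c n q1].
Proof.
move=> ab; elim: l E q => [|s l IHl] E q sE nE sq //=.
case Ek: PM.find => [k|]; last exact: IHl.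
have bk := sE.1 _ _ _ Ek; rewrite nE in bk.
have ak : arrow c n a (val s) k by rewrite -[val s]mul1g; exact: (arrowM ab bk).
case El: PM.find => [m|]; last first.
  by apply: IHl => //; apply: sound_set_entry => //; rewrite nE.
have am := sE.1 _ _ _ El; rewrite nE in am.
apply: IHl => // d e [[<- <-]|]; last exact: sq.
by rewrite -(mulVg (val s)); apply: (arrowM _ ak); apply: arrowV.
Qed.

Lemma sound_coincide c fuel E q :
    sound c E -> queue_sound c (next_coset E) q ->
  sound c (coincide fuel E q) /\ next_coset (coincide fuel E q) = next_coset E.
Proof.
elim: fuel E q => [|f IHf] E [|[a b] q] sE sq //=.
have sq' : queue_sound c (next_coset E) q by move=> d e de; apply: sq; right.
have ab0 : arrow c (next_coset E) a 1 b by apply: sq; left.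
have [lt_a lt_b _] := ab0.
have := sound_live sE lt_a; have := sound_live sE lt_b.
set a' := live _ a; set b' := live _ b => bb' aa'.
have ab : arrow c (next_coset E) a' 1 b'.
  rewrite -[1]mulg1; apply: (arrowM _ bb'); rewrite -[1]mulg1.
  by apply: (arrowM _ ab0); rewrite -invg1; apply: arrowV.
case: Pos.eqb; first exact: IHf.
(* The smaller number survives. The argument is the same for both orders, so it is made once, for a
   survivor [d] and a coset [e] that dies. *)
have key d e : arrow c (next_coset E) d 1 e ->
  let E1 := State (next_coset E) (tab E) (PM.add e d (dead E)) in
  let E2 := (let: (E2, q1) := absorb_all d e E1 q in coincide f E2 q1) in
  sound c E2 /\ next_coset E2 = next_coset E.
  move=> de E1; have sE1 : sound c E1.
    split=> [|i j] /=; first exact: sE.1.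
    have [->|ne] := Pos.eq_dec i e; last by rewrite PM.gso //; apply: sE.2.
    by rewrite PM.gss => -[<-]; rewrite -invg1; apply: arrowV.
  have := @sound_absorb c _ d e [:: sx; sX; sy; sY; st] E1 q de sE1 erefl sq'.
  rewrite /absorb_all; case: foldl => E2 q1 [sE2 nE2 sq2].
  by rewrite -nE2; apply: IHf => //; rewrite nE2.
case: Pos.ltb; first exact: key.
by apply: key; rewrite -invg1; apply: arrowV.
Qed.

(** The forward trace splits the relator as $w=uw_1$ and the backward trace splits $w_1^{-1}=vw_2$,
    so $w=1$ gives $u=vw_2$. Hence $w_2^{-1}$ leads from the end [i] of the first trace to the end
    [j] of the second: an empty $w_2$ is a coincidence, a single letter a new edge, and a longer
    rest yields nothing. *)
Lemma sound_scan c E k w :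
    sound c E -> word_val x y t w = 1 ->
  sound c (scan E k w) /\ next_coset (scan E k w) = next_coset E.
Proof.
move=> sE w1; rewrite /scan; case: Pos.ltb_spec => // lt_k.
have [_ {}lt_k _] := sound_live sE lt_k; move: (live _ k) lt_k => {}k lt_k.
have [u Ew] := sound_follow w sE lt_k; case: (follow E k w) Ew => i w1' /= Ew ki.
have [v] := sound_follow (symsV w1') sE lt_k.
case: (follow E k _) => j w2 /= Ev kj.
have uv : word_val x y t u = word_val x y t v * word_val x y t w2.
  rewrite -word_val_cat -Ev word_valV //; apply: (mulIg (word_val x y t w1')).
  by rewrite mulVg -word_val_cat -Ew.
have ij : arrow c (next_coset E) i (word_val x y t w2)^-1 j.
  suff -> : (word_val x y t w2)^-1 = (word_val x y t u)^-1 * word_val x y t v.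
    by apply: (arrowM _ kj); apply: arrowV.
  by rewrite uv invgM mulgKV.
case: w2 {Ev uv} ij => [|s [|? ?]] //= ij.
  by apply: sound_coincide => // ? ? [[<- <-]|[]]; rewrite -invg1.
by split=> //; apply: sound_set_edge; rewrite // sym_valV -1?[val s]mulg1.
Qed.

(** The new coset is represented by $c_i$ times the letter. Old representatives are kept; in
    particular coset 1 stays represented by 1, which [coset_countP] uses to read off the coset of a
    word. *)
Lemma sound_define c E i s :
  sound c E -> exists c', sound c' (define E i s) /\
    (forall j, (j < next_coset E)%positive -> c' j = c j).
Proof.
move=> sE; rewrite /define; case: Pos.ltb_spec => [lt_i|_]; last by exists c.
set n := next_coset E.
pose c' j := if Pos.eqb j n then c i * val s else c j.
have c'E j : (j < n)%positive -> c' j = c j.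
  by rewrite /c'; case: Pos.eqb_spec => // -> /Pos.lt_irrefl.
have lift j g k : arrow c n j g k -> arrow c' (Pos.succ n) j g k.
  by case=> ? ? ?; split; rewrite ?c'E //; apply: Pos.lt_lt_succ.
exists c'; split=> //; apply: sound_set_edge.
  by split=> [j u k /sE.1/lift | j k /sE.2/lift].
split; [exact: Pos.lt_lt_succ | exact: Pos.lt_succ_diag_r |].
by rewrite c'E // /c' Pos.eqb_refl mulgV.
Qed.

Variable rels : seq (seq sym).
Hypothesis rels1 : all (fun w => word_val x y t w == 1) rels.

Lemma sound_step c E k :
    sound c E -> exists c', [/\ sound c' (step rels E k),
      (next_coset E <= next_coset (step rels E k))%positive &
      forall j, (j < next_coset E)%positive -> c' j = c j].
Proof.
move=> sE; rewrite /step; set i := (if _ is Npos p then p else _).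
have scanP r : exists c', [/\ sound c' (scan E i (nth [::] rels r)),
    (next_coset E <= next_coset (scan E i (nth [::] rels r)))%positive &
      forall j, (j < next_coset E)%positive -> c' j = c j].
  have w1 : word_val x y t (nth [::] rels r) = 1.
    have [lt_r|le_r] := ltnP r (size rels); last by rewrite nth_default.
    exact/eqP/(all_nthP [::] rels1).
  by have [sE' nE'] := sound_scan i sE w1; exists c; split=> //;
    rewrite nE'; apply: Pos.le_refl.
have defP s : exists c', [/\ sound c' (define E i s),
    (next_coset E <= next_coset (define E i s))%positive &
      forall j, (j < next_coset E)%positive -> c' j = c j].
  have [c' [sc' cE]] := sound_define i s sE; exists c'; split=> //.
  rewrite /define; case: Pos.ltb => /=; last exact: Pos.le_refl.
  exact/Pos.lt_le_incl/Pos.lt_succ_diag_r.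
(* The five codes of definitions have at most three binary digits, so three case splits decide every
   branch. *)
case: N.land => [|p]; first exact: defP.
by do 3?[case: p => [p|p|]]; first [exact: defP | exact: scanP].
Qed.

Lemma sound_steps c E steps :
    sound c E -> (1 < next_coset E)%positive -> exists c',
  [/\ sound c' (foldl (step rels) E steps),
      (1 < next_coset (foldl (step rels) E steps))%positive & c' xH = c xH].
Proof.
elim: steps c E => [|k steps IHs] c E sE lt1 /=; first by exists c.
have [c1 [sE1 le_n c1E]] := sound_step k sE.
have [|c2 [sE2 lt2 c2E]] := IHs c1 _ sE1; first exact: Pos.lt_le_trans le_n.
by exists c2; split=> //; rewrite c2E c1E.
Qed.

Lemma sound_start sub :
    {in sub, forall s, K (val s)} ->
  sound (fun=> 1) (start sub) /\ next_coset (start sub) = 2%positive.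
Proof.
rewrite /start; set E := State _ _ _ => Ksub.
have: sound (fun=> 1) E by split=> [i s j | i j]; rewrite PM.gempty.
have: next_coset E = 2%positive by [].
elim: sub E Ksub => [|s sub IHs] E Ksub nE sE //=.
apply: IHs => //; first by move=> u sub_u; apply: Ksub; rewrite inE sub_u orbT.
apply: sound_set_edge => //; rewrite nE; split=> //.
by rewrite mul1g invg1 mulg1; apply: Ksub; rewrite mem_head.
Qed.

(** A word is traced from coset 1 through the table, and [closed_under] keeps the trace inside the
    list of cosets; where it ends, the representative lies in the same coset as the word. The
    successor [n.+1] excludes the value 0 that signals an incomplete table. *)
Theorem coset_countP sub gens steps n :
    {in sub, forall s, K (val s)} ->
    coset_count rels sub gens steps = n.+1 ->
  exists2 r : seq G, size r = n.+1 &
    forall w, {subset w <= gens} ->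
      exists2 g, g \in r & K (word_val x y t w * g^-1).
Proof.
move=> Ksub; rewrite /coset_count.
set E := foldl _ _ _; move: (reachable _ _ _ _ _) => l.
have [s0 n0] := sound_start Ksub.
have [|c [sE lt1 c1]] := sound_steps steps s0; first by rewrite n0.
rewrite -/E in sE lt1; move: E sE lt1 => E sE lt1.
case: ifP => // /andP[l1 lgens] sz_l.
exists [seq c i | i <- l]; first by rewrite size_map.
have mem_l i : has (Pos.eqb i) l -> c i \in [seq c j | j <- l].
  elim: (l) => //= j l' IHl /orP[/Pos.eqb_eq-> | /IHl]; rewrite inE ?eqxx //.
  by move=> ->; rewrite orbT.
have all_l i : has (Pos.eqb i) l -> forall s, s \in gens ->
    exists2 j, lookup E i s = Some j & has (Pos.eqb j) l.
  move=> /(all_has_eqb lgens)/allP lP s /lP.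
  by case: lookup => // j lj; exists j.
have trace w i g : has (Pos.eqb i) l -> arrow c (next_coset E) 1 g i ->
    {subset w <= gens} ->
  exists2 j, has (Pos.eqb j) l &
    arrow c (next_coset E) 1 (g * word_val x y t w) j.
  elim: w i g => [|s w IHw] i g li gi ws /=; first by exists i; rewrite ?mulg1.
  have [|j Ej lj] := all_l i li s; first by apply: ws; rewrite mem_head.
  rewrite mulgA; apply: (IHw j) => // [|u wu]; last first.
    by apply: ws; rewrite inE wu orbT.
  exact: (arrowM gi (sound_lookup sE Ej)).
move=> w /(trace w xH 1 l1 (arrow_id c lt1)) [j lj [_ _ Kj]].
by exists (c j); [exact: mem_l | rewrite c1 !mul1g in Kj].
Qed.

End Soundness.

(** * The enumerations *)

Declare Scope term_scope.
Delimit Scope term_scope with T.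
Notation "a * b" := (Tmul a b) : term_scope.
Notation "a ^-1" := (Tinv a) : term_scope.
Notation "a ^+ n" := (Texp a n) : term_scope.
Notation "a ^- n" := (Tinv (Texp a n)) : term_scope.

Definition N_rels : seq term :=
  [:: Tx ^+ 10; Ty ^+ 6; (Tx * Ty ^- 2 * Tx) ^+ 2;
      (Tx * Ty ^+ 2 * Tx ^+ 2) ^+ 2; (Ty^-1 * Tx^-1) ^+ 5;
      (Tx * Ty ^+ 2 * Tx^-1 * Ty^-1) ^+ 2;
      Tx^-1 * Ty^-1 * Tx ^+ 5 * Ty * Tx ^- 4;
      Ty * Tx ^- 2 * Ty^-1 * Tx ^+ 3 * Ty * Tx * Ty ^+ 3 * Tx^-1]%T.

(** Conjugates and commutators are spelled out with the bracketing of their definitions, so that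
    evaluation agrees by conversion with the relators in [pres_rels]. *)
Definition t_rels : seq term :=
  [:: Tt ^+ 2; Tt^-1 * ((Tx ^+ 2)^-1 * (Tt * Tx ^+ 2));
      Tt^-1 * ((Ty ^+ 2)^-1 * (Tt * Ty ^+ 2));
      (Tx * Ty ^- 2 * Tx * Ty * (Tx^-1 * (Tt * Tx))) ^+ 6]%T.

Definition presG_rels : seq term := N_rels ++ t_rels ++ [:: (Tx * Tt) ^+ 5]%T.

Definition calG_rels : seq term :=
  N_rels ++ t_rels ++ [:: (Tx ^+ 5 * Ty ^+ 3 * Tt) ^+ 3]%T.

(* Runs of the Todd-Coxeter procedure, pruned to the definitions and deductions
   on which the final coset table depends. *)
Definition N_steps : seq N := [::
    34; 35; 66; 64; 65; 96; 97; 99; 129; 39; 130; 134; 128; 289; 40; 419;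
    391; 162; 160; 193; 171; 163; 194; 195; 226; 224; 257; 235; 546; 199;
    227; 258; 259; 322; 323; 579; 42; 352; 353; 387; 418; 674; 106; 1059;
    1062; 448; 449; 482; 963; 966; 1281; 1324; 480; 865; 265; 1315; 167;
    481; 1409; 200; 1475; 999; 514; 1122; 1516; 1570; 1574; 547; 576; 577;
    610; 929; 936; 960; 71; 608; 609; 640; 641; 643; 1730; 1734; 672; 673;
    706; 1635; 1638; 1699; 1322; 739; 1089; 1095; 1536; 2220; 768; 2211;
    2214; 2145; 2151; 2152; 769; 1249; 519; 1762; 935; 800; 2243; 522; 1153;
    74; 801; 931; 295; 2593; 2536; 834; 2050; 2058; 2695; 2339; 2342; 832;
    1890; 650; 2242; 1545; 833; 1794; 268; 2881; 2859; 864; 1505; 1481;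
    2978; 2888; 896; 2562; 2572; 1186; 458; 780; 897; 3072; 3051; 1152; 135;
    994; 3203; 298; 3265; 3272; 995; 1056; 1066; 1442; 1452; 1026; 2080;
    1036; 3392; 3399; 1027; 1120; 1128; 3552; 1415; 1057; 1064; 3555; 3558;
    1132; 3648; 364; 1184; 1443; 3367; 3624; 3714; 204; 1187; 2274; 2278;
    3715; 1191; 3884; 1218; 1858; 3785; 1985; 1866; 1219; 2018; 681; 4033;
    2540; 1280; 2016; 2023; 2049; 2027; 1313; 4096; 1803; 1378; 1388; 2698;
    2663; 1609; 4267; 1344; 1441; 491; 2700; 4034; 4007; 1347; 2370; 2374;
    3104; 775; 3113; 1377; 4458; 3171; 332; 4524; 3147; 4396; 4515; 2951;
    1411; 1538; 1542; 4609; 551; 1514; 3234; 3238; 360; 1068; 1738; 1859;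
    4684; 1867; 1420; 1537; 2176; 267; 4770; 4743; 748; 4775; 2508; 1568;
    2056; 4300; 1888; 1895; 839; 1897; 4544; 3079; 4554; 2890; 1632; 3521;
    2922; 44; 3520; 3463; 4994; 3530; 5002; 615; 5025; 5031; 1704; 1320;
    1666; 2304; 2247; 2313; 1482; 3018; 4291; 1351; 2984; 1667; 2378; 4353;
    4135; 4329; 1770; 4963; 4488; 1698; 2119; 2946; 873; 5313; 5319; 3880;
    1763; 1766; 3969; 4489; 5410; 5414; 4967; 1795; 1798; 2919; 840; 5184;
    5192; 5067; 4643; 1959; 5511; 2472; 2051; 2054; 1607; 3304; 5187; 5190;
    970; 5600; 583; 5609; 2305; 2311; 1575; 2369; 2375; 871; 5699; 5702;
    2279; 2376; 5667; 5670; 3527; 4936; 4608; 4615; 1479; 4616; 2402; 2406;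
    2121; 2467; 5735; 3464; 3232; 3239; 3655; 3240; 5376; 4263; 5384; 5923;
    5926; 2818; 2822; 2826; 5985; 5991; 5865; 6017; 6023; 5992; 2817; 2728;
    6081; 6087; 1991; 2824; 5952; 5959; 4231; 5960]%num.

Definition presG_steps : seq N := [::
    36; 65; 46; 67; 47; 98; 72; 100; 193; 110; 113; 195; 111; 226; 200; 129;
    132; 355; 143; 128; 419; 74; 161; 164; 160; 547; 106; 257; 260; 643;
    271; 256; 707; 202; 289; 292; 803; 303; 288; 867; 234; 322; 321; 544;
    75; 577; 172; 1026; 327; 1056; 1034; 1000; 1090; 1064; 140; 323; 326;
    1058; 424; 963; 1130; 1217; 492; 1250; 1161; 928; 330; 1153; 108; 324;
    1184; 1255; 1292; 1410; 1418; 1441; 972; 1473; 1448; 1127; 1506; 458;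
    1512; 1537; 1514; 456; 1347; 1066; 1600; 1610; 1032; 1607; 353; 964;
    366; 352; 1060; 1070; 1763; 1071; 385; 388; 384; 420; 1376; 1934; 452;
    1987; 463; 484; 1760; 2062; 1699; 975; 1762; 2063; 1730; 360; 2083;
    1767; 1891; 362; 513; 1092; 526; 1920; 2318; 512; 996; 1006; 2400; 1390;
    548; 1697; 974; 2048; 2478; 2466; 2479; 2531; 2504; 2082; 1768; 1667;
    1736; 580; 2691; 591; 610; 609; 864; 203; 897; 300; 2850; 615; 2880;
    2858; 2824; 2914; 2888; 268; 611; 614; 2882; 712; 2787; 2954; 3041; 780;
    3074; 2985; 2752; 618; 2977; 236; 612; 3008; 3079; 3116; 3234; 3242;
    3265; 2796; 3297; 3272; 2951; 3330; 746; 3336; 3361; 3338; 744; 3171;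
    2890; 3424; 3434; 2856; 3431; 641; 2788; 654; 640; 2884; 2894; 3587;
    2895; 708; 3200; 3662; 3651; 719; 740; 772; 3584; 3790; 3523; 2799;
    3586; 3791; 3554; 648; 3811; 3591; 801; 2916; 814; 3648; 4014; 3202;
    4015; 800; 2820; 2830; 4128; 3214; 4099; 4168; 3970; 4008; 4035; 3976;
    4034; 4038; 3203; 623; 4002; 4143; 836; 4387; 847; 832; 868; 900; 4515;
    911; 932; 1028; 1124; 4578; 4655; 1156; 4579; 943; 4642; 4719; 1188;
    4577; 942; 4610; 4815; 1220; 4704; 4910; 4802; 4911; 4611; 1039; 1252;
    1284; 1985; 462; 1316; 4705; 1166; 5026; 5135; 1348; 5025; 1262; 4576;
    5230; 5283; 5256; 1412; 5121; 1326; 5250; 5224; 1444; 2689; 590; 5218;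
    5455; 1476; 4609; 1038; 1984; 5550; 5058; 5551; 5603; 5576; 5602; 5606;
    5571; 5543; 5090; 1991; 5091; 5094; 1508; 5441; 1454; 5027; 1263; 5122;
    5839; 4640; 5838; 1540; 5345; 1422; 4896; 5998; 5538; 5999; 5059; 1295;
    4834; 4583; 5474; 5448; 1572; 4801; 1198; 5024; 6222; 5346; 6223; 6275;
    6248; 6274; 6278; 6243; 4840; 1604; 5057; 1294; 4608; 6446; 6210; 6447;
    5347; 1423; 6499; 6472; 5570; 5544; 5155; 4936; 1636; 4641; 1134; 2688;
    6702; 5442; 6703; 5219; 1359; 5955; 5864; 6722; 6696; 6723; 5960; 6754;
    2696; 6755; 6728; 1668; 1732; 7008; 7054; 7043; 1743; 1793; 1796; 1792;
    7203; 1706; 1826; 1825; 1828; 1827; 1857; 7300; 1870; 1856; 1892; 7328;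
    7502; 7491; 1903; 1888; 7298; 1831; 7266; 391; 7648; 1739; 7299; 392;
    7586; 7590; 7650; 1804; 7778; 7786; 7782; 7809; 7816; 7843; 2538; 7456;
    7918; 1956; 2017; 2020; 8003; 2031; 2016; 2084; 7040; 8110; 7010; 8111;
    2113; 2116; 7171; 1807; 2112; 2145; 2148; 8227; 2127; 7170; 8367; 2144;
    8291; 2058; 2177; 2180; 2176; 2209; 2212; 2208; 8579; 1738; 2241; 2244;
    8771; 2255; 2240; 2276; 7076; 7089; 8896; 8942; 8928; 8974; 8960; 9006;
    8992; 7950; 9028; 9038; 9056; 9102; 9090; 9103; 2340; 8865; 2286; 7936;
    9166; 9220; 9230; 9248; 9294; 9280; 7022; 9326; 9251; 9320; 9058; 8104;
    8131; 9064; 8130; 8134; 7011; 1679; 8098; 9295; 7075; 8136; 2561; 2564;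
    9603; 2575; 2560; 8451; 1770; 8290; 2122; 2596; 9763; 2607; 2625; 2628;
    2624; 9891; 2090; 2636; 2657; 2660; 9858; 9999; 2656; 8738; 8748; 10080;
    363; 8739; 10055; 10145; 8328; 10147; 10183; 10082; 10086; 7713; 7692;
    7744; 10279; 8610; 10154; 8675; 1674; 8578; 2186; 8705; 10444; 2721;
    10433; 10185; 10498; 7754; 10435; 8295; 10561; 8616; 10595; 10636; 9953;
    9959; 10657; 7144; 10691; 10732; 8193; 8199; 10753; 9960; 10787; 10828;
    9825; 9831; 2724; 10883; 2735; 10849; 8200; 10947; 9832; 10988; 10946;
    10950; 9827; 10855; 9826; 10858; 10594; 9896; 10659; 10730; 7139; 7208;
    7138; 10570; 11040; 7148; 11041; 10508; 2720; 11267; 10090; 11072; 1708;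
    11073; 11239; 11394; 11402; 11136; 8202; 11458; 8743; 11488; 7595; 8747;
    11522; 11050; 11552; 8844; 11584; 1772; 11619; 10056; 11648; 2507; 2756;
    11616; 8204; 11554; 11496; 10307; 10313; 11811; 7594; 11852; 11808;
    2508; 11872; 11877; 9696; 9674; 11938; 9706; 8840; 10977; 10060; 12012;
    11906; 11914; 11875; 11755; 12064; 2216; 2852; 12098; 12106; 12072;
    11778; 10346; 12194; 10410; 10409; 12225; 7880; 7360; 7818; 12288;
    12296; 8524; 12320; 2248; 12290; 12298; 12258; 10218; 12266; 12259;
    9578; 12448; 12458; 11368; 11690; 12449; 12456; 7244; 2948; 12355; 8842;
    12577; 12584; 12611; 11943; 12459; 12640; 11880; 12675; 12681; 12707;
    9898; 12647; 9728; 8298; 11240; 8704; 8682; 11400; 12802; 8714; 12810;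
    8835; 11786; 12867; 1898; 10984; 2980; 12896; 7368; 12963; 10188; 12992;
    13002; 12168; 12999; 12995; 12394; 13056; 12328; 13091; 13097; 13120;
    13128; 13127; 13123; 7240; 13187; 10602; 11111; 13184; 13194; 13226;
    3012; 13248; 13258; 10698; 11528; 13219; 10506; 13344; 10216; 13379;
    9928; 13385; 13408; 13418; 12970; 13440; 13450; 8330; 11816; 13152;
    13162; 9962; 13504; 13514; 13386; 11592; 3044; 3076; 3108; 3140; 3172;
    3236; 3268; 3300; 3332; 3364; 3396; 3428; 3460; 4512; 3492; 3556; 14016;
    14062; 3620; 3616; 3844; 3840; 3876; 3872; 3908; 3904; 3972; 14084;
    14097; 14400; 14446; 14432; 14464; 14510; 4036; 4068; 4064; 4196; 4192;
    4228; 4224; 4260; 4256; 4292; 4288; 4324; 4320; 4356; 4352; 4384; 4548;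
    4544; 4673; 4676; 4672; 8066; 2026; 4737; 4740; 15139; 4687; 4736;
    15331; 4714; 4769; 4772; 15267; 4751; 15138; 4768; 8067; 1994; 15170;
    4682; 4836; 4865; 4868; 4864; 11299; 2698; 4932; 4961; 4964; 15682;
    15855; 4960; 15907; 4810; 4993; 4996; 4992; 15715; 4618; 11298; 2730;
    5092; 5156; 15777; 4942; 16196; 16177; 16225; 4846; 5185; 5188; 5184;
    5252; 5284; 16385; 5262; 15616; 16430; 16484; 16494; 16512; 16558;
    16544; 16590; 16576; 16622; 16547; 6063; 15778; 16431; 5316; 5312; 5380;
    16161; 5166; 16608; 16782; 16836; 16846; 16866; 16392; 16864; 16942;
    16928; 16270; 16974; 16963; 16815; 5409; 5408; 17059; 5258; 5476; 16611;
    6031; 16930; 17135; 5505; 5508; 5504; 5572; 5604; 17313; 5582; 15779;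
    4943; 16418; 17359; 16128; 17358; 17476; 17489; 17504; 17550; 17536;
    17582; 17568; 17614; 17603; 6735; 17538; 15631; 17539; 6767; 16451;
    16872; 5633; 16579; 16463; 5636; 5632; 5665; 5668; 16706; 17935; 5664;
    5697; 5700; 16707; 5327; 17922; 18063; 5696; 5732; 5728; 5761; 5760;
    5793; 5792; 5860; 17121; 5486; 18404; 17486; 18435; 17480; 18434; 18438;
    18402; 17583; 18403; 18447; 17602; 16259; 18433; 5102; 5889; 5892; 5888;
    5921; 5924; 5920; 17858; 5642; 5956; 18369; 5870; 17600; 18926; 18980;
    18990; 18947; 18408; 18946; 18920; 19008; 19118; 19104; 19150; 19139;
    18959; 6084; 6080; 6116; 6112; 18754; 5898; 6145; 6148; 6144; 18147;
    5610; 6177; 6180; 6176; 6308; 6304; 18755; 5834; 19298; 6122; 6337;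
    6340; 6336; 6369; 6372; 6368; 6404; 6400; 6532; 6528; 19235; 5546; 6564;
    6560; 6593; 6596; 6592; 19875; 6282; 19554; 6186; 6628; 18178; 20303;
    6624; 19938; 6410; 6657; 6660; 18179; 5743; 20290; 20463; 6656; 17986;
    5674; 6785; 6788; 6784; 20003; 6218; 19234; 6090; 6817; 6820; 6816;
    17859; 5066; 18850; 5930; 6849; 6848; 18339; 5386; 18274; 5770; 6884;
    19907; 6415; 6880; 17987; 5290; 20546; 6666; 6916; 21059; 6895; 19906;
    6912; 6948; 19395; 6159; 6944; 16738; 5322; 6977; 6980; 21347; 6959;
    19394; 21519; 6976; 19939; 5866; 20354; 6634; 7105; 7108; 21731; 7119;
    7104; 7140; 7169; 10564; 7182; 7168; 10948; 10958; 7204; 21824; 21998;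
    7236; 22051; 7247; 7268; 7652; 22145; 7662; 9761; 2606; 7329; 22210;
    22152; 7812; 7342; 22305; 7822; 22307; 7823; 22306; 7343; 22211; 22344;
    22242; 22312; 7523; 22184; 22339; 7364; 22115; 7279; 7396; 7427; 7684;
    7439; 7524; 22723; 7535; 7553; 7556; 7552; 7620; 7716; 7748; 7780;
    22563; 7375; 22114; 22991; 7876; 7970; 7969; 20192; 6443; 21633; 6636;
    23202; 7975; 23232; 23176; 23266; 23240; 5644; 15106; 4679; 15107;
    15110; 19810; 6375; 19811; 19814; 19489; 6184; 23457; 2023; 23491;
    23146; 7972; 15233; 15239; 23585; 19496; 23619; 23660; 23651; 23306;
    23681; 23688; 23715; 23756; 15393; 15399; 23777; 19816; 23811; 23852;
    23779; 23850; 23714; 15176; 19713; 19719; 7971; 19872; 19880; 24003;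
    19879; 24000; 23496; 24066; 24074; 24098; 24008; 15111; 15234; 23594;
    15235; 15238; 23618; 23591; 23683; 23754; 19715; 19784; 19714; 23946;
    8001; 23140; 8014; 24130; 15336; 8000; 23236; 23246; 24483; 23247; 8032;
    8161; 8160; 21795; 7050; 8196; 8225; 10756; 8238; 8224; 10180; 10190;
    24803; 10191; 8257; 8256; 8292; 24672; 8324; 8353; 10116; 8366; 25058;
    21967; 8352; 10692; 10702; 25155; 10703; 8385; 8384; 8417; 8420; 8416;
    8452; 24992; 25390; 24931; 8303; 8484; 8516; 24739; 10767; 25154; 25519;
    8545; 11684; 8544; 12068; 12078; 25698; 25007; 8580; 25504; 25774; 8612;
    24800; 25838; 25059; 10127; 21954; 25839; 25122; 8360; 25251; 8641;
    10148; 8654; 24928; 26062; 8640; 10788; 10798; 26144; 24686; 21827;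
    7151; 8676; 24737; 10766; 25824; 26254; 21859; 21928; 25763; 8591; 8708;
    8740; 8769; 11428; 8782; 8768; 11492; 11502; 26563; 11503; 8801; 8800;
    8836; 9345; 9344; 9376; 26755; 9258; 9412; 9408; 9441; 9444; 9440;
    26787; 9066; 26754; 9354; 9473; 9476; 9472; 24611; 7018; 21794; 7114;
    9508; 9537; 9572; 25696; 27310; 26051; 10159; 26114; 8648; 26179; 26151;
    9601; 12100; 9614; 25760; 27502; 25859; 26312; 25027; 25128; 9600;
    24770; 24807; 25123; 25126; 11652; 11662; 27712; 25518; 25026; 8359;
    27523; 27464; 25794; 27715; 11663; 9633; 9632; 24899; 8234; 25346; 8426;
    25347; 25350; 21922; 9668; 25633; 11694; 27296; 28110; 25379; 8463;
    9700; 25475; 8495; 9732; 9793; 9828; 21952; 28366; 24802; 28367; 21891;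
    10575; 26275; 24712; 9857; 10852; 9870; 28546; 26159; 28545; 10862;
    24962; 24680; 28610; 21992; 28515; 28551; 9856; 10596; 28768; 21838;
    28770; 24687; 9892; 21889; 10574; 28352; 28878; 28866; 28879; 24707;
    24776; 9924; 29027; 9935; 9956; 25152; 29102; 27714; 29103; 28899;
    21864; 9985; 10660; 9998; 29250; 28783; 29251; 29249; 10670; 22018;
    21832; 24963; 24966; 25603; 25672; 27331; 28168; 9984; 10084; 10094;
    29536; 29570; 29544; 10052; 29088; 29646; 25762; 29647; 10608; 28395;
    28490; 25163; 24876; 8236; 26249; 28970; 8428; 8395; 25809; 28527;
    28526; 28174; 25679; 25678; 22031; 26191; 25281; 25288; 29730; 24906;
    25996; 10212; 22944; 29806; 10244; 22913; 7726; 29795; 10223; 10276;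
    10308; 10340; 10372; 26403; 10404; 30051; 10383; 26402; 30127; 10436;
    10466; 23904; 10476; 10465; 20960; 5835; 20577; 6892; 30370; 10471;
    30400; 30344; 30434; 30408; 6796; 15970; 4999; 15971; 15974; 18306;
    5799; 18307; 18310; 18241; 5768; 30625; 2727; 30659; 30314; 15809;
    15815; 30721; 18248; 30755; 30796; 30787; 30474; 30817; 30824; 30851;
    15649; 15655; 30913; 18312; 30947; 30988; 30850; 16040; 10467; 23873;
    30279; 18336; 18344; 31107; 18343; 31148; 31104; 30664; 31170; 31202;
    15975; 31232; 31240; 31112; 17026; 31274; 17027; 17030; 31234; 31271;
    15811; 15912; 10500; 26401; 8718; 10532; 29952; 31502; 29986; 31503;
    10628; 10724; 26560; 31630; 10820; 10881; 30308; 10894; 10880; 30404;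
    30414; 31811; 30415; 10980; 30018; 31887; 11012; 30019; 31874; 31951;
    11044; 11076; 11108; 11140; 11172; 32065; 11086; 31682; 32175; 11204;
    11236; 11268; 32064; 32334; 11332; 22976; 32398; 29955; 10287; 11364;
    11396; 11460; 11524; 11556; 11588; 30016; 32654; 11620; 32129; 11150;
    11748; 11780; 11812; 32128; 32846; 31427; 10511; 11844; 26497; 11438;
    31616; 32942; 32995; 31650; 26568; 29987; 10319; 31490; 32943; 11876;
    30017; 10350; 11908; 11940; 11972; 29985; 10318; 26499; 11439; 26562;
    33295; 12004; 12036; 25473; 12164; 12196; 12228; 29792; 33582; 12260;
    22561; 7374; 32387; 11343; 29954; 33647; 29984; 33646; 31651; 33000;
    33793; 32432; 33792; 33870; 33856; 15278; 33345; 31627; 33358; 33359;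
    19503; 33376; 15150; 32962; 32966; 12292; 33568; 34030; 26467; 26536;
    12324; 33281; 11982; 22560; 34126; 31619; 10735; 34179; 34152; 12356;
    12388; 12420; 12452; 28225; 9710; 32322; 34383; 33536; 34382; 12484;
    33249; 11950; 33155; 11887; 12516; 34497; 12494; 30112; 34606; 34659;
    34632; 12580; 33248; 34734; 12612; 33505; 12174; 33442; 12644; 32161;
    11182; 33218; 34895; 12676; 12708; 22880; 35022; 34274; 35023; 12740;
    31681; 10830; 34722; 35119; 26400; 35118; 35203; 35144; 35202; 26408;
    12772; 31425; 10510; 31680; 35310; 34882; 35311; 33219; 11919; 34626;
    34600; 34531; 34760; 12804; 12836; 33411; 12015; 34594; 35567; 12868;
    31873; 10990; 32643; 11599; 25472; 35662; 34467; 34408; 12900; 29857;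
    10254; 34018; 35823; 33603; 34056; 12964; 29953; 10286; 26466; 26504;
    33763; 33766; 22112; 35950; 36066; 35943; 36067; 35976; 12996; 33441;
    12046; 31872; 36174; 13028; 31585; 10638; 31426; 36271; 13060; 22977;
    7790; 35939; 29024; 36366; 13092; 22049; 7246; 35008; 36494; 13124;
    35552; 36590; 13156; 32096; 13188; 22912; 36718; 36483; 13103; 13220;
    33409; 12014; 31584; 36814; 36866; 31592; 13252; 22113; 7278; 31488;
    36942; 31618; 36943; 34115; 12335; 34147; 33320; 36387; 13316; 36704;
    37166; 35010; 37167; 13348; 22881; 7630; 22048; 37262; 36482; 37263;
    36707; 13199; 37282; 37256; 37314; 22056; 13380; 29025; 9934; 32384;
    37486; 35938; 37487; 36355; 13071; 37539; 37512; 37506; 37480; 13412;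
    13444; 35553; 12846; 34499; 12495; 31936; 37742; 35747; 35688; 33474;
    25479; 13476; 32097; 11118; 36803; 13231; 36578; 37935; 37763; 36616;
    35746; 35750; 35683; 35655; 34466; 13508; 31937; 36576; 38190; 38211;
    13540; 37697; 13422; 36640; 38318; 34786; 38319; 33443; 12047; 15136;
    33985; 33896; 23726; 19812; 19822; 24387; 23151; 36394; 37642; 24488;
    37483; 32971; 37641; 23150; 35948; 22572; 37098; 36970; 37100; 36015;
    20143; 26474; 33292; 32972; 36009; 26572; 33390; 33098; 32938; 33097;
    26634; 26606; 34216; 34217; 15307; 36135; 37099; 23790; 36032; 33134;
    20964; 30352; 30318; 32362; 31720; 31755; 35787; 35690; 35402; 30319;
    36880; 15946; 5292; 20617; 30284; 20876; 6832; 36907; 30026; 22923;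
    37200; 5584; 6992; 24848; 26990; 7505; 22288; 26767; 26766; 22727; 9260;
    8107; 7665; 10160; 7056]%num.

Definition calG_steps : seq N := [::
    36; 65; 46; 67; 47; 98; 72; 100; 193; 110; 132; 259; 143; 128; 323; 74;
    129; 195; 111; 164; 160; 483; 106; 161; 226; 200; 228; 609; 238; 256;
    611; 239; 257; 642; 616; 292; 803; 303; 288; 289; 324; 320; 672; 1006;
    356; 1027; 367; 352; 545; 331; 353; 140; 1154; 551; 388; 929; 334; 385;
    389; 49; 174; 1198; 398; 1283; 1191; 387; 386; 135; 390; 547; 488; 420;
    1443; 431; 416; 1507; 202; 417; 1282; 391; 172; 484; 1635; 495; 516;
    1699; 527; 512; 1345; 393; 548; 1633; 494; 580; 1891; 591; 576; 1955;
    234; 577; 992; 1838; 676; 675; 674; 994; 1839; 704; 2211; 618; 705;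
    1794; 522; 396; 740; 2081; 686; 737; 142; 2401; 2405; 739; 680; 738;
    2408; 999; 2435; 744; 772; 2563; 783; 768; 769; 1858; 1639; 800; 995;
    975; 801; 1826; 2415; 866; 298; 2083; 687; 868; 864; 2720; 2990; 900;
    897; 2785; 302; 899; 2979; 2727; 898; 2944; 2951; 1024; 2689; 875; 1025;
    3266; 3208; 1060; 3363; 1071; 1056; 2947; 2991; 1057; 2946; 2950; 1092;
    1376; 108; 1088; 3232; 3662; 1091; 359; 3616; 1384; 3721; 2316; 1090;
    361; 3745; 3719; 972; 1156; 3553; 1102; 1153; 1159; 3875; 3881; 1383;
    332; 1316; 3873; 3593; 3879; 1415; 1348; 3937; 1326; 1380; 3811; 1167;
    1412; 4065; 1390; 1440; 3939; 1327; 1441; 4002; 4079; 1472; 4003; 1359;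
    3297; 366; 1508; 1504; 4192; 4494; 1540; 1536; 2017; 1515; 1537; 428;
    4610; 2023; 1572; 4417; 1518; 1569; 1573; 113; 590; 3214; 3041; 1582;
    1571; 4769; 4773; 872; 1583; 1570; 4591; 4835; 1895; 1604; 3648; 4942;
    1668; 4995; 1679; 1664; 4131; 1423; 1665; 3938; 4943; 1696; 3972; 3982;
    1697; 3716; 1710; 1732; 1728; 5282; 5231; 1729; 5216; 3822; 1713; 1764;
    4385; 3886; 1796; 4064; 5550; 4145; 1035; 1860; 5603; 1871; 1956; 1988;
    5699; 1999; 1984; 4801; 1577; 1985; 5836; 588; 4864; 236; 2020; 5665;
    1966; 2019; 1960; 2018; 583; 5985; 2028; 2052; 5601; 1870; 2080; 6062;
    2338; 6063; 2116; 6179; 2127; 2112; 2113; 6019; 4650; 6313; 5984; 204;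
    2180; 4865; 6023; 4875; 2176; 5058; 1674; 2177; 6402; 5961; 5962; 4547;
    1543; 6343; 6412; 6018; 4809; 5991; 5763; 1991; 5863; 6028; 5891; 2031;
    2212; 6691; 2223; 2208; 2657; 2219; 2241; 716; 6818; 2663; 2273; 2277;
    2308; 5474; 6927; 2337; 2436; 2350; 2339; 751; 6050; 7023; 2372; 2371;
    6120; 6978; 2343; 2468; 7009; 6087; 2464; 6242; 2122; 2465; 6114; 2088;
    2500; 7202; 7407; 2496; 6243; 682; 2497; 7266; 2474; 2532; 7203; 2479;
    2528; 7651; 2058; 2540; 2529; 7394; 7599; 2561; 6788; 2574; 2592; 4480;
    5902; 1457; 2756; 6371; 2191; 2752; 7971; 2410; 2753; 8001; 8076; 2764;
    2820; 7907; 2767; 2816; 5059; 1642; 2817; 6434; 2186; 6370; 8111; 4320;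
    4203; 7822; 2852; 2848; 2849; 7264; 8428; 2884; 8483; 2880; 7521; 7527;
    2881; 8577; 300; 2976; 3268; 3278; 3073; 4836; 3086; 3108; 8769; 8773;
    3104; 8386; 2858; 3105; 7296; 7305; 3140; 7331; 7337; 3136; 3137; 6274;
    6284; 3172; 8802; 9167; 3168; 8387; 874; 3169; 6275; 8871; 3236; 8866;
    3114; 3235; 1031; 3234; 3300; 3332; 3328; 9313; 268; 3329; 9571; 9577;
    9644; 3360; 9376; 9639; 3361; 9698; 9708; 9760; 9767; 9765; 7617; 2513;
    3918; 3428; 3780; 3790; 3424; 9664; 9966; 3427; 9890; 5487; 3426; 4096;
    4074; 3460; 9506; 10127; 3457; 9635; 9543; 3492; 9857; 3438; 3489; 9729;
    1070; 3491; 9955; 9671; 3490; 9923; 9967; 3524; 9507; 3343; 3520; 9539;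
    3274; 3521; 9120; 1836; 3552; 3557; 10691; 3559; 3555; 3588; 3567; 3554;
    9839; 10787; 3599; 3651; 3631; 5283; 3727; 3650; 3748; 3759; 10978;
    4399; 3936; 4967; 1032; 5571; 5574; 4001; 1735; 5544; 3598; 9831; 5093;
    5096; 5473; 5477; 4036; 9346; 11183; 4100; 11139; 5512; 4097; 4962;
    4935; 4129; 11143; 11362; 9896; 4164; 11363; 9895; 4163; 4135; 10433;
    3500; 8462; 8463; 4162; 4071; 5187; 1703; 9891; 3791; 4195; 1482; 4258;
    1447; 4260; 4257; 430; 4292; 11235; 4111; 4288; 11843; 4010; 4300; 4289;
    11746; 4495; 4356; 11779; 4303; 4352; 4362; 12035; 3818; 4353; 10369;
    3308; 8590; 12135; 12047; 5071; 12046; 6446; 6564; 4513; 6596; 4526;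
    12226; 12175; 4548; 4612; 12289; 4558; 4804; 4868; 4900; 4896; 10563;
    2954; 4897; 4841; 12546; 8231; 12550; 4964; 9344; 12622; 4963; 3655;
    5506; 4391; 4992; 12576; 908; 4993; 12771; 12583; 5024; 6497; 6501;
    5025; 11297; 11304; 5056; 12736; 13038; 5092; 9475; 3311; 5121; 12801;
    1678; 5123; 3503; 5064; 3276; 9216; 2855; 5122; 8591; 9607; 13248;
    13253; 5156; 5188; 11427; 4175; 5218; 5252; 13345; 5198; 5312; 10692;
    10702; 5313; 5444; 5326; 13602; 13551; 13344; 13614; 5380; 13441; 13445;
    5376; 13474; 13448; 5377; 13667; 13351; 5508; 9473; 3310; 5572; 13313;
    5166; 9347; 5633; 11170; 13967; 11424; 13966; 13731; 13480; 5696; 6628;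
    6638; 5697; 6532; 5732; 5728; 14274; 14223; 5729; 12288; 14286; 5764;
    12225; 6606; 5796; 12416; 14542; 5828; 14465; 5774; 5860; 12385; 4814;
    12291; 4559; 5956; 12417; 4878; 5988; 12384; 14830; 6020; 14528; 14659;
    5871; 6082; 6056; 7235; 5607; 6116; 6148; 6144; 8547; 2090; 6145; 12290;
    14895; 6176; 10305; 369; 5483; 6177; 12097; 6187; 6212; 13889; 5518;
    6244; 6240; 2504; 15470; 15424; 13166; 7297; 15532; 2508; 6276; 15425;
    6254; 6273; 12775; 15620; 15630; 6190; 6308; 14816; 15694; 6340; 6368;
    12580; 12590; 6369; 12900; 6382; 6404; 14657; 5870; 6468; 15680; 15685;
    14833; 10511; 14769; 6464; 6473; 16035; 10568; 6465; 16108; 2828; 16097;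
    15465; 4780; 6499; 6505; 12903; 8963; 8872; 6498; 2183; 16225; 12522;
    9610; 15521; 13001; 2956; 8960; 8908; 16192; 13287; 12483; 4903; 16385;
    16428; 7561; 6948; 6944; 6945; 7044; 7040; 7041; 8546; 2890; 7076;
    16547; 7072; 16739; 7073; 15074; 16687; 7172; 7168; 16899; 6986; 7169;
    7201; 12772; 7214; 7268; 15873; 12910; 7300; 15426; 17071; 7332; 17057;
    7278; 7330; 2471; 12770; 1676; 7364; 16866; 17327; 7360; 17281; 12780;
    12898; 2124; 7392; 15329; 4940; 8238; 7393; 11527; 17538; 10376; 7460;
    15427; 6255; 7492; 17123; 7311; 7488; 9377; 9225; 17739; 8876; 7489;
    16423; 17804; 13282; 4908; 7524; 17601; 7470; 7523; 17825; 16103; 7522;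
    2503; 17923; 17926; 7975; 7977; 7556; 7584; 18083; 7754; 7596; 7585;
    17122; 18063; 7620; 13312; 18222; 7652; 18275; 7663; 7648; 7655; 18338;
    18342; 7680; 7687; 18402; 9324; 7716; 18273; 7662; 7713; 7719; 6508;
    8033; 8039; 8037; 7715; 18535; 7714; 2535; 15490; 17232; 7748; 13057;
    5102; 7904; 18020; 18030; 7905; 18564; 18574; 7918; 18859; 18031; 7343;
    7535; 13135; 17862; 15808; 15813; 15816; 6379; 7936; 18883; 12808;
    17195; 7937; 18465; 7972; 8004; 8000; 8007; 3116; 19106; 8009; 10215;
    8036; 19041; 7982; 8035; 8041; 18567; 16419; 16425; 8034; 2759; 19297;
    8044; 7468; 8068; 8065; 9223; 1585; 19394; 8071; 19404; 19395; 19401;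
    19271; 19468; 8096; 8644; 8654; 8097; 9796; 8110; 8128; 19586; 15823;
    8129; 19649; 15884; 17100; 17065; 15879; 15788; 7948; 17228; 12939;
    19622; 8140; 17068; 17612; 18321; 18929; 7183; 7182; 8113; 16583; 16901;
    7052; 7049; 2380; 8622; 7056; 12137; 12039; 5516; 10379; 9418; 8656;
    9425; 12143; 10892; 9672; 5164; 5292; 10348; 12040; 9960; 5227; 5579;
    10346; 11114; 7598; 9680; 10896; 11601; 19057; 4305; 7625; 6188; 7207;
    10860; 5137; 10823; 9232; 8207; 16111; 8206; 15215; 9263; 2864; 6256;
    8879; 10671; 8878; 9583; 13743; 8014; 6471; 12273; 16303; 9039; 8974;
    17774; 10641; 8873; 1004; 9840; 11471; 4016; 16334; 8270; 14191; 11025;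
    17807; 19439; 4849; 14032; 6545; 9711; 17295; 14945; 16263; 19756; 7502;
    9024; 19463; 19790; 19747; 10607; 16391; 9090; 13903; 10217; 16231;
    9585; 18369; 8233; 8263; 19884; 17806; 9248; 9255; 13863; 7566; 19906;
    16335; 19951; 9257; 14380; 10626; 13615; 10636; 8172; 13681; 18433;
    9289; 9383; 17294; 16036; 16047; 19823; 16046; 9392]%num.

Lemma N_count :
  coset_count (map term_word N_rels) [:: sx] [:: sx; sX; sy; sY] N_steps
    = 192.
Proof. by vm_compute. Qed.

Lemma presG_count :
  coset_count (map term_word presG_rels) [:: sx; sy]
    [:: sx; sX; sy; sY; st] presG_steps
    = 315.
Proof. by vm_compute. Qed.

Lemma calG_count :
  coset_count (map term_word calG_rels) [:: sx; sy]
    [:: sx; sX; sy; sY; st] calG_steps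
    = 315.
Proof. by vm_compute. Qed.

Lemma subset_symsV w :
  {subset w <= [:: sx; sX; sy; sY]} -> {subset symsV w <= [:: sx; sX; sy; sY]}.
Proof. by move=> ow s; rewrite mem_rev => /mapP[u /ow u_xy ->]; case: u u_xy. Qed.

(** * Upper bounds for the orders *)

Section Bounds.
Variables (G : groupType) (x y t : G).
Hypothesis t2 : t ^+ 2 = 1.

Lemma relators_word rels :
    all (fun e => term_val x y t e == 1) rels ->
  all (fun w => word_val x y t w == 1) (map term_word rels).
Proof.
by rewrite all_map; apply: sub_all => e /=; rewrite word_val_term.
Qed.

Lemma N_bound :
    all (fun e => term_val x y t e == 1) N_rels ->
  exists2 l : seq G, size l = (10 * 192)%N &
    forall w, {subset w <= [:: sx; sX; sy; sY]} -> word_val x y t w \in l.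
Proof.
move=> rel1; have x10 : x ^+ 10 = 1 by apply/eqP; case/andP: rel1.
pose K g := exists i, g = x ^+ i.
have K1 : K 1 by exists 0.
have KM g h : K g -> K h -> K (g * h).
  by case=> i -> [j ->]; exists (i + j)%N; rewrite expgnDr.
have KV g : K g -> K g^-1.
  (* As $x^{10}=1$, the inverse of $x^i$ is $x^{9i}$; exponents thus stay natural numbers. *)
  case=> i ->; exists (i * 9)%N; apply: (mulgI (x ^+ i)).
  by rewrite mulgV -expgnDr -mulnS mulnC expgnA x10 expg1n.
have Kx : {in [:: sx], forall s, K (sym_val x y t s)}.
  move=> s; rewrite inE => /eqP->; by exists 1%N; rewrite expg1.
have [r sz_r rP] := coset_countP t2 K1 KM KV (relators_word rel1) Kx N_count.
exists [seq x ^+ i * g | i <- iota 0 10, g <- r].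
  by rewrite size_allpairs size_iota sz_r.
move=> w /rP[g rg [i /(canRL (mulgKV _)) ->]].
apply/allpairsP; exists (i %% 10, g)%N; split=> //.
  by rewrite mem_iota /= ltn_mod.
by rewrite /= {1}(divn_eq i 10) expgnDr mulnC expgnA x10 expg1n mul1g.
Qed.

Lemma G_bound rels steps :
    all (fun e => term_val x y t e == 1) (N_rels ++ rels) ->
    coset_count (map term_word (N_rels ++ rels)) [:: sx; sy]
      [:: sx; sX; sy; sY; st] steps = 315 ->
  exists2 l : seq G, size l = (10 * 192 * 315)%N &
    forall w, word_val x y t w \in l.
Proof.
move=> rel1 count.
pose K g := exists2 w : seq sym,
  {subset w <= [:: sx; sX; sy; sY]} & g = word_val x y t w.
have K1 : K 1 by exists [::].
have KM g h : K g -> K h -> K (g * h).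
  move=> [u ou ->] [v ov ->]; exists (u ++ v); last by rewrite word_val_cat.
  by move=> s; rewrite mem_cat => /orP[/ou | /ov].
have KV g : K g -> K g^-1.
  by move=> [u ou ->]; exists (symsV u); [exact: subset_symsV | rewrite word_valV].
have Kxy : {in [:: sx; sy], forall s, K (sym_val x y t s)}.
  move=> s xy_s; exists [:: s]; last by rewrite /= mulg1.
  by move=> u; rewrite inE => /eqP->; case: s xy_s.
have [r sz_r rP] := coset_countP t2 K1 KM KV (relators_word rel1) Kxy count.
move: rel1; rewrite all_cat => /andP[/N_bound[l sz_l lP] _].
exists [seq h * g | h <- l, g <- r].
  by rewrite size_allpairs sz_l sz_r.
move=> w; have [|g rg [u ou /(canRL (mulgKV _)) ->]] := rP w.
  by case.
by apply/allpairsP; exists (word_val x y t u, g); split=> //; apply: lP.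
Qed.

End Bounds.

(** Pigeonhole: the image of [l] covers [gT] and is no longer than [gT], so it has no repetition.
    Two elements with the same image then have the same position in [l], which gives injectivity
    although [G] carries no finite structure. *)
Lemma bij_of_bound (G : groupType) (gT : finType) (f : G -> gT) (l : seq G) :
    (forall g, g \in l) -> size l <= #|gT| -> (forall a, exists g, f g = a) ->
  bijective f.
Proof.
move=> lP le_l f_surj; have sub_l : {subset enum gT <= map f l}.
  by move=> a _; have [g <-] := f_surj a; apply: map_f.
have Ul : uniq (map f l).
  apply: leq_size_uniq sub_l _; first exact: enum_uniq.
  by rewrite size_map -cardE.
have f_inj : injective f.
  move=> g h fgh; rewrite -(nth_index g (lP g)) -(nth_index g (lP h)).
  congr nth; apply/eqP; rewrite -(nth_uniq (f g) _ _ Ul) ?size_map ?index_mem //.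
  by rewrite !(nth_map g) ?index_mem // !nth_index // fgh.
by have [h fh] := choice f_surj; exists h => [g|//]; apply: f_inj.
Qed.

(** * Computing with permutations *)

Section Tables.
Variable n : nat.
Implicit Types (p : 'S_n.+1) (i : 'I_n.+1).

Definition ptab p : seq nat := [seq val (p i) | i <- enum 'I_n.+1].

Lemma ptabE p (F : nat -> nat) :
  (forall i, val (p i) = F (val i)) -> ptab p = map F (iota 0 n.+1).
Proof. by move=> pF; rewrite -val_enum_ord -map_comp; apply: eq_map. Qed.

Lemma ptab1 : ptab 1 = iota 0 n.+1.
Proof. by rewrite (@ptabE 1 id) ?map_id // => i; rewrite perm1. Qed.

Lemma nth_ptab p i : nth 0 (ptab p) i = val (p i).
Proof. by rewrite (nth_map ord0) ?size_enum_ord // nth_ord_enum. Qed.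

Lemma size_ptab p : size (ptab p) = n.+1.
Proof. by rewrite size_map size_enum_ord. Qed.

Lemma ptab_inj : injective ptab.
Proof.
by move=> p q pq; apply/permP=> i; apply: val_inj; rewrite -!nth_ptab pq.
Qed.

Definition inv_tab (l : seq nat) : seq nat :=
  [seq index k l | k <- iota 0 (size l)].

Lemma ptabV p : ptab p^-1 = inv_tab (ptab p).
Proof.
rewrite /inv_tab size_ptab; apply: ptabE => i.
have Up : uniq (ptab p).
  by rewrite map_inj_uniq ?enum_uniq // => j k /val_inj/perm_inj.
by rewrite -[in RHS](permKV p i) -(nth_ptab p) index_uniq ?size_ptab.
Qed.

(** Cycle notation counts points from 1 and tables count from 0, hence [predn]. The left fold
    matches the right action of a product. *)
Definition act_cycles (cs : seq (seq nat)) (k : nat) : nat :=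
  foldl (fun j c => next (map predn c) j) k cs.

(** The range condition makes [point] faithful: [inord] sends numbers that are too large to a
    default, and 0 would be confused with 1. *)
Lemma ptab_cycles cs :
    all (fun c => uniq c && all (fun k => 0 < k <= n.+1) c) cs ->
  ptab (perm_of_cycles n cs) = map (act_cycles cs) (iota 0 n.+1).
Proof.
move=> csP; apply: ptabE => i; rewrite /perm_of_cycles /act_cycles.
elim: cs csP i => [|c cs IHcs] /=; first by move=> _ i; rewrite big_nil perm1.
case/andP=> /andP[Uc /allP c_n] csP i; rewrite big_cons permM IHcs //.
congr (foldl _ _ cs).
have Ec : map predn c = map val (map (point n) c).
  rewrite -map_comp; apply/eq_in_map => k /c_n /andP[k_gt0 le_k].
  by rewrite /= inordK // prednK.
have Up : uniq (map (point n) c).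
  apply: (@map_uniq _ _ val); rewrite -Ec map_inj_in_uniq // => j k cj ck.
  by move: (c_n j cj) (c_n k ck); case: j {cj} => // j _; case: k {ck} => //= k _ ->.
by rewrite cycle_permE // Ec next_map //; apply: val_inj.
Qed.

Definition act_word (tb : sym -> seq nat) (w : seq sym) (k : nat) : nat :=
  foldl (fun j s => nth 0 (tb s) j) k w.

Definition word_tab tb w : seq nat := map (act_word tb w) (iota 0 n.+1).

Variables (x y t : 'S_n.+1) (tb : sym -> seq nat).
Hypothesis tbE : forall s, tb s = ptab (sym_val x y t s).

Lemma val_word w i : val (word_val x y t w i) = act_word tb w (val i).
Proof.
elim: w i => [|s w IHw] i /=; first by rewrite perm1.
by rewrite permM IHw tbE nth_ptab.
Qed.

Lemma ptab_word w : ptab (word_val x y t w) = word_tab tb w.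
Proof. by apply: ptabE => i; apply: val_word. Qed.

Lemma word_eq1 w : word_tab tb w = iota 0 n.+1 -> word_val x y t w = 1.
Proof.
by rewrite -ptab_word => E; apply: ptab_inj; rewrite E ptab1.
Qed.

Fixpoint orbit_search fuel (ws : seq (seq sym)) (seen todo : seq nat) :=
  match fuel, todo with
  | fuel'.+1, k :: todo' =>
      let new := undup [seq j <- [seq act_word tb w k | w <- ws] | j \notin seen] in
      orbit_search fuel' ws (new ++ seen) (todo' ++ new)
  | _, _ => seen
  end.

(* A level is a base point, words fixing the earlier base points, and a lower
   bound for the length of the orbit of the base point under these words. *)
Fixpoint stab_chain (fixed : seq nat) (levels : seq (nat * seq (seq sym) * nat)) :=
  if levels is (b, ws, m) :: levels' then
    let orb := orbit_search n.+1 ws [:: b] [:: b] in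
    [&& b < n.+1, all (fun w => all (fun k => act_word tb w k == k) fixed) ws,
        uniq orb, m <= size orb & stab_chain (b :: fixed) levels']
  else true.

Lemma orbit_searchP (H : {group 'S_n.+1}) fuel ws i seen todo :
    (forall w, w \in ws -> word_val x y t w \in H) -> {subset todo <= seen} ->
    {subset seen <= [seq val j | j in orbit 'P H i]} ->
  {subset orbit_search fuel ws seen todo <= [seq val j | j in orbit 'P H i]}.
Proof.
move=> wsH; elim: fuel seen todo => [|f IHf] seen [|k todo] //= ts sO.
have new_sub : {subset
      undup [seq j <- [seq act_word tb w k | w <- ws] | j \notin seen]
    <= [seq val j | j in orbit 'P H i]}.
  move=> j; rewrite mem_undup mem_filter => /andP[_ /mapP[w ws_w ->]].
  have /sO/imageP[a Oa ->] : k \in seen by apply: ts; rewrite mem_head.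
  rewrite -val_word; apply: image_f.
  by apply: orbit_trans Oa; apply: mem_orbit; apply: wsH.
apply: IHf => j; rewrite !mem_cat => /orP[].
- by move=> tj; rewrite ts ?orbT // inE tj orbT.
- by move->.
- exact: new_sub.
exact: sO.
Qed.

(** Induction by the orbit-stabiliser theorem, replacing [H] by the stabiliser of the base point.
    The hypothesis is inherited because a word that also fixes [b] evaluates into that stabiliser.
    The points found by the search lie in the orbit, which suffices for a lower bound. *)
Lemma stab_chain_bound (H : {group 'S_n.+1}) fixed levels :
    (forall w, all (fun k => act_word tb w k == k) fixed ->
       word_val x y t w \in H) ->
    stab_chain fixed levels ->
  \prod_(l <- levels) l.2 <= #|H|.
Proof.
elim: levels H fixed => [|[[b ws] m] levels IHl] H fixed wH /=.
  by rewrite big_nil cardG_gt0.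
case/and5P=> lt_b /allP ws_fix Uorb le_m chain; rewrite big_cons /=.
pose i := Ordinal lt_b; rewrite -(card_orbit_stab 'P H i).
apply: leq_mul; last first.
  apply: (IHl _ (b :: fixed)) => //= w /andP[wb w_fix].
  rewrite inE wH //=; apply/astab1P/val_inj; rewrite /= /aperm val_word.
  exact/eqP.
apply: leq_trans le_m _; rewrite -(size_image val).
apply: uniq_leq_size Uorb _.
apply: (@orbit_searchP H n.+1 ws i [:: b] [:: b]) => // [w ws_w | j].
  exact/wH/ws_fix.
by rewrite inE => /eqP->; apply/imageP; exists i; rewrite ?orbit_refl.
Qed.

End Tables.

Lemma term_val_tab n (x y t : 'S_n.+1) tb rels :
    (forall s, tb s = ptab (sym_val x y t s)) -> t ^+ 2 = 1 ->
    all (fun e => word_tab n tb (term_word e) == iota 0 n.+1) rels ->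
  all (fun e => term_val x y t e == 1) rels.
Proof.
move=> tbE t2; apply: sub_all => e /eqP/(word_eq1 tbE).
by rewrite word_val_term // => ->.
Qed.

Lemma mem_word_val (gT : finGroupType) (H : {group gT}) x y t w :
  x \in H -> y \in H -> t \in H -> word_val x y t w \in H.
Proof.
move=> Hx Hy Ht; elim: w => [|s w IHw] /=; first exact: group1.
by rewrite groupM //; case: s => /=; rewrite ?groupV.
Qed.

(** A subset of a finite group that contains 1 and is closed under products is a subgroup, so no
    clause for inverses appears. *)
Lemma gen2_ind (gT : finGroupType) (a b : gT) (P : gT -> Prop) :
    P 1 -> (forall p q, P p -> P q -> P (p * q)) -> P a -> P b ->
  {in <<[set a; b]>>, forall p, P p}.
Proof.
move=> P1 PM Pa Pb p; rewrite -[P p]asboolE.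
have gP : group_set [set q | `[< P q >]].
  apply/group_setP; split=> [|q r]; rewrite !inE; first exact/asboolP.
  by move=> /asboolP Pq /asboolP Pr; apply/asboolP/PM.
have: <<[set a; b]>> \subset group gP.
  by rewrite gen_subG; apply/subsetP=> q; rewrite !inE => /orP[] /eqP->;
     apply/asboolP.
by move/subsetP=> sub /sub; rewrite inE.
Qed.

(** * The permutation groups *)

Definition x32_tab : seq nat := [::
    1; 0; 4; 5; 6; 8; 10; 12; 13; 15; 16; 18; 19; 21; 23; 24; 3; 7; 27; 28;
    11; 2; 9; 26; 29; 14; 30; 31; 22; 17; 20; 25]%N.

Definition y32_tab : seq nat := [::
    2; 3; 0; 1; 7; 9; 11; 4; 14; 5; 17; 16; 20; 22; 21; 25; 26; 8; 28; 12;
    23; 27; 6; 29; 15; 18; 13; 10; 30; 31; 24; 19]%N.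

Definition J2a_tab : seq nat := [::
    83; 19; 47; 55; 81; 66; 54; 40; 34; 39; 77; 99; 48; 36; 93; 75; 18; 43;
    16; 1; 33; 84; 91; 56; 74; 27; 63; 25; 89; 96; 37; 67; 68; 20; 8; 52;
    13; 30; 60; 9; 7; 72; 90; 17; 85; 80; 88; 2; 12; 92; 95; 71; 35; 73; 6;
    3; 23; 98; 94; 62; 38; 82; 59; 26; 69; 87; 5; 31; 32; 64; 86; 51; 41;
    53; 24; 15; 97; 10; 79; 78; 45; 4; 61; 0; 21; 44; 70; 65; 46; 28; 42;
    22; 49; 14; 58; 50; 29; 76; 57; 11]%N.

Definition J2b_tab : seq nat := [::
    79; 8; 52; 22; 50; 36; 6; 26; 10; 61; 1; 64; 63; 60; 97; 72; 38; 4; 12;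
    96; 95; 0; 77; 5; 14; 92; 59; 56; 70; 68; 11; 15; 16; 85; 27; 35; 23;
    58; 32; 42; 40; 67; 90; 41; 29; 84; 9; 75; 91; 65; 17; 13; 86; 94; 28;
    53; 34; 19; 93; 7; 51; 46; 73; 18; 30; 87; 20; 43; 44; 80; 54; 62; 31;
    71; 69; 89; 48; 3; 99; 21; 74; 33; 78; 83; 88; 81; 2; 49; 45; 47; 39;
    76; 98; 37; 55; 66; 57; 24; 25; 82]%N.

Lemma ptab_x32 : ptab x32 = x32_tab.
Proof. by rewrite ptab_cycles; vm_compute. Qed.

Lemma ptab_y32 : ptab y32 = y32_tab.
Proof. by rewrite ptab_cycles; vm_compute. Qed.

Lemma ptab_J2a : ptab J2a = J2a_tab.
Proof. by rewrite ptab_cycles; vm_compute. Qed.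

Lemma ptab_J2b : ptab J2b = J2b_tab.
Proof. by rewrite ptab_cycles; vm_compute. Qed.

Definition x32V_tab := Eval vm_compute in inv_tab x32_tab.
Definition y32V_tab := Eval vm_compute in inv_tab y32_tab.
Definition J2aV_tab := Eval vm_compute in inv_tab J2a_tab.
Definition J2bV_tab := Eval vm_compute in inv_tab J2b_tab.

Definition N_tab (s : sym) : seq nat :=
  match s with
  | sx => x32_tab | sX => x32V_tab | sy => y32_tab | sY => y32V_tab
  | st => iota 0 32
  end.

Lemma N_tabE s : N_tab s = ptab (sym_val x32 y32 1 s).
Proof.
by case: s; rewrite /= ?ptabV ?ptab1 ?ptab_x32 ?ptab_y32 //; vm_compute.
Qed.

Definition ab_tab (s : sym) : seq nat :=
  match s with
  | sx => J2a_tab | sX => J2aV_tab | sy => J2b_tab | sY => J2bV_tab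
  | st => iota 0 100
  end.

Lemma ab_tabE s : ab_tab s = ptab (sym_val J2a J2b 1 s).
Proof.
by case: s; rewrite /= ?ptabV ?ptab1 ?ptab_J2a ?ptab_J2b //; vm_compute.
Qed.

Lemma N32_rels : all (fun e => term_val x32 y32 1 e == 1) N_rels.
Proof. by apply: (term_val_tab N_tabE); [rewrite expg1n | vm_compute]. Qed.

Lemma N32_order : (32 * 20 * 3 <= #|N32|)%N.
Proof.
(* Base points count from 0. The squares $x^2$ and $y^2$, with which $t$ is made to commute, fix the
   first point; $y^2$ also fixes the second base point and moves the third in a 3-cycle. *)
pose levels := [:: (0, [:: [:: sx]; [:: sy]], 32);
  (7, [:: [:: sx; sx]; [:: sy; sy]], 20); (6, [:: [:: sy; sy]], 3)]%N.
suff: \prod_(l <- levels) l.2 <= #|N32|.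
  by rewrite /levels !big_cons big_nil /= muln1 !mulnA.
apply: (@stab_chain_bound _ _ _ _ _ N_tabE N32 [::]) => [w _|]; last by vm_compute.
by apply: mem_word_val; rewrite ?x32_N ?y32_N ?group1.
Qed.

(* Found by a search for words in the standard generators of J_2 which satisfy
   the relators of [presG]; sx and sy stand for J2a and J2b. *)
Definition X_word : seq sym := [::
    sx; sy; sx; sY; sx; sy; sx; sy; sx; sY; sx; sy; sx; sY; sx; sy; sx; sY;
    sx; sY; sx; sy; sx; sY; sx; sY; sx; sy; sx; sy; sx; sY; sx; sY; sx; sy;
    sx; sy; sx; sY; sx; sY; sx; sy; sx; sy; sx; sY].

Definition Y_word : seq sym := [::
    sY; sx; sy; sx; sY; sx; sy; sx; sY; sx; sy; sx; sy; sx; sY; sx; sY; sx;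
    sy; sx; sY; sx; sY; sx; sy; sx; sy; sx].

Definition T_word : seq sym :=
  flatten (nseq 6 [:: sx; sY; sx; sY; sx; sy; sx; sy]).

Definition J2x : 'S_100 := word_val J2a J2b 1 X_word.
Definition J2y : 'S_100 := word_val J2a J2b 1 Y_word.
Definition J2t : 'S_100 := word_val J2a J2b 1 T_word.

Definition J2x_tab := Eval vm_compute in word_tab 99 ab_tab X_word.
Definition J2y_tab := Eval vm_compute in word_tab 99 ab_tab Y_word.
Definition J2t_tab := Eval vm_compute in word_tab 99 ab_tab T_word.
Definition J2xV_tab := Eval vm_compute in inv_tab J2x_tab.
Definition J2yV_tab := Eval vm_compute in inv_tab J2y_tab.

Definition J2_tab (s : sym) : seq nat :=
  match s with
  | sx => J2x_tab | sX => J2xV_tab | sy => J2y_tab | sY => J2yV_tab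
  | st => J2t_tab
  end.

Lemma J2_tabE s : J2_tab s = ptab (sym_val J2x J2y J2t s).
Proof.
have px : ptab J2x = J2x_tab by rewrite (ptab_word ab_tabE); vm_compute.
have py : ptab J2y = J2y_tab by rewrite (ptab_word ab_tabE); vm_compute.
have pt : ptab J2t = J2t_tab by rewrite (ptab_word ab_tabE); vm_compute.
by case: s; rewrite /= ?ptabV ?px ?py ?pt //; vm_compute.
Qed.

Lemma J2t_2 : J2t ^+ 2 = 1.
Proof.
have -> : J2t ^+ 2 = word_val J2x J2y J2t [:: st; st].
  by rewrite expgS expg1 /= mulg1.
by apply: (word_eq1 J2_tabE); vm_compute.
Qed.

Lemma J2_presG_rels : all (fun e => term_val J2x J2y J2t e == 1) presG_rels.
Proof. by apply: (term_val_tab J2_tabE J2t_2); vm_compute. Qed.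

Lemma J2_calG_rels : all (fun e => term_val J2x J2y J2t e == 1) calG_rels.
Proof. by apply: (term_val_tab J2_tabE J2t_2); vm_compute. Qed.

(** Together with [J2bE] this inverts the words above: [J2x], [J2y] and [J2t] generate all of [J2],
    as surjectivity requires. *)
Lemma J2aE : J2a = word_val J2x J2y J2t [:: sX; sX; sy; sy].
Proof.
by apply: ptab_inj; rewrite (ptab_word J2_tabE) ptab_J2a; vm_compute.
Qed.

Lemma J2bE : J2b = word_val J2x J2y J2t [:: sx; sy; sx; st; sy; st; sY].
Proof.
by apply: ptab_inj; rewrite (ptab_word J2_tabE) ptab_J2b; vm_compute.
Qed.

Lemma J2xyt_in : [/\ J2x \in J2, J2y \in J2 & J2t \in J2].
Proof.
have J2a_in : J2a \in J2 by rewrite mem_gen // !inE eqxx.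
have J2b_in : J2b \in J2 by rewrite mem_gen // !inE eqxx orbT.
by split; apply: mem_word_val; rewrite ?group1.
Qed.

Lemma J2_order : (100 * 63 * 12 * 8 <= #|J2|)%N.
Proof.
(* The point stabiliser is $U_3(3)$, of order $6048$, with orbits of lengths 1, 36 and 63. The
   second base point lies in the longest one, which leaves $6048/63=96=12\cdot 8$. *)
pose levels := [:: (0, [:: [:: sx]; [:: sy]; [:: st]], 100);
  (1, [:: [:: sX; sY; st]; [:: sy; st; sY]], 63);
  (7, [:: [:: sx; sx; sx; sx; sY; sY]; [:: sx; sY; st; sX; sy; sy; st]], 12);
  (5, [:: [:: sY; sx; sy; sy; st; sy; st; sX; sy];
          [:: st; sy; sX; sy; st; sY; sx; sY; st]], 8)]%N.
suff: \prod_(l <- levels) l.2 <= #|J2|.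
  by rewrite /levels !big_cons big_nil /= muln1 !mulnA.
apply: (@stab_chain_bound _ _ _ _ _ J2_tabE J2 [::]) => [w _|]; last by vm_compute.
by have [? ? ?] := J2xyt_in; apply: mem_word_val.
Qed.

(** * Presentations *)

Definition gen (k : nat) : free_group 'I_3 := free_gen (point 2 k).

Section Presentation.
Variable rels : seq term.

(** For [presG_rels] this is [presG] by conversion. *)
Definition pres_of : groupType :=
  presented [seq term_val (gen 1) (gen 2) (gen 3) e | e <- rels].

Definition pgen (k : nat) : pres_of := pres_gen _ (point 2 k).

Lemma pres_of_rels :
  all (fun e => term_val (pgen 1) (pgen 2) (pgen 3) e == 1) rels.
Proof.
rewrite /pgen /pres_gen; set q := quot_proj _.
have: all (fun r => q r == 1)
    [seq term_val (gen 1) (gen 2) (gen 3) e | e <- rels].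
  apply/allP=> r r_rels; apply/eqP/esym/quot_projP; rewrite invg1 mul1g.
  exact: normal_closure_gen.
rewrite all_map; apply: sub_all => e /=.
by rewrite /q (term_val_morph _ _ _ _ (quot_projM _)).
Qed.

Lemma pres_of_word (g : pres_of) :
  pgen 3 ^+ 2 = 1 -> exists w, g = word_val (pgen 1) (pgen 2) (pgen 3) w.
Proof.
move=> t2; rewrite -(quot_repr g) -(free_repr (generic_quotient.repr g)).
elim: (generic_quotient.repr _) => [|[i b] u [w IHw]]; first by exists [::].
rewrite -cat1s free_class_cat quot_projM {}IHw.
suff [v ->] : exists v, quot_proj _ (free_class [:: (i, b)])
    = word_val (pgen 1) (pgen 2) (pgen 3) v.
  by exists (v ++ w); rewrite word_val_cat.
have [v Ev] : exists v,
    pres_gen [seq term_val (gen 1) (gen 2) (gen 3) e | e <- rels] i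
    = word_val (pgen 1) (pgen 2) (pgen 3) v.
  case: i => -[|[|[|//]]] lt_i.
  - exists [:: sx]; rewrite /= mulg1; congr pres_gen; apply: val_inj.
    by rewrite /= inordK.
  - exists [:: sy]; rewrite /= mulg1; congr pres_gen; apply: val_inj.
    by rewrite /= inordK.
  exists [:: st]; rewrite /= mulg1; congr pres_gen; apply: val_inj.
  by rewrite /= inordK.
case: b; last by exists v.
exists (symsV v); rewrite word_valV // -Ev.
rewrite -[RHS]/(quot_inv (quot_proj _ (free_gen i))) quot_invE.
by congr quot_proj; rewrite -[RHS]free_classV.
Qed.

(** Von Dyck's theorem for three generators. *)
Lemma pres_of_hom (H : groupType) (a b c : H) :
    all (fun e => term_val a b c e == 1) rels ->
  exists f : {multiplicative pres_of -> H},
    [/\ f (pgen 1) = a, f (pgen 2) = b & f (pgen 3) = c].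
Proof.
move=> rels1; pose v (i : 'I_3) := nth a [:: a; b; c] i.
have vE k d : (0 < k <= 3)%N -> nth a [:: a; b; c] k.-1 = d ->
    free_lift v (gen k) = d.
  case/andP=> k_gt0 le_k Ed.
  by rewrite free_lift_gen /v /point inordK ?prednK.
have v1 : forall r, r \in [seq term_val (gen 1) (gen 2) (gen 3) e | e <- rels] ->
    free_lift v r = 1.
  suff /allP r1 : all (fun r => free_lift v r == 1)
      [seq term_val (gen 1) (gen 2) (gen 3) e | e <- rels].
    by move=> r /r1/eqP.
  rewrite all_map; apply: sub_all rels1 => e /=.
  rewrite (term_val_morph _ _ _ _ (free_liftM v)).
  by rewrite (vE 1%N a) ?(vE 2 b) ?(vE 3 c).
have fM := quot_liftM (free_liftM v) v1.
pose f : {multiplicative pres_of -> H} :=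
  HB.pack (quot_lift (free_lift v)) (isMultiplicative.Build _ _ _ fM).
exists f.
split; rewrite /f /= /pgen /pres_gen (quot_liftE (free_liftM v) v1);
  by rewrite (vE _ _ _ erefl).
Qed.

End Presentation.

Lemma card_subg_of (gT : finGroupType) (H : {group gT}) : #|subg_of H| = #|H|.
Proof. by rewrite (card_isog (isog_subg H)) cardsT. Qed.

Lemma gen2_surj (gT : finGroupType) (a b : gT) (G : groupType)
    (f : {multiplicative G -> subg_of <<[set a; b]>>}) g h :
    sgval (f g) = a -> sgval (f h) = b ->
  forall p, exists k, f k = p.
Proof.
move=> fg fh p.
suff [k fk] : exists k, sgval (f k) = sgval p by exists k; apply: val_inj.
move: (sgval p) (subgP p); apply: gen2_ind => [|q r [k <-] [m <-]||].
- by exists 1; rewrite (morph_one (@gmulfM _ _ f)).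
- by exists (k * m); rewrite gmulfM.
- by exists g.
by exists h.
Qed.

(* N_rels present N32: by the enumeration over <x> they define a group of order
   at most 1920 = 32 * 20 * 3. *)
Lemma N32_hom (H : groupType) (a b : H) :
    all (fun e => term_val a b 1 e == 1) N_rels ->
  exists f : {multiplicative subg_of N32 -> H},
    f (subg N32 x32) = a /\ f (subg N32 y32) = b.
Proof.
(* [pres_of] always has three generators; the relator $t$ kills the third, leaving the group
   presented on $x,y$ by the relators of $N$. *)
move=> relsH; pose rels := N_rels ++ [:: Tt]; pose A := pres_of rels.
have ext (K : groupType) (c d : K) :
    all (fun e => term_val c d 1 e == 1) N_rels ->
  all (fun e => term_val c d 1 e == 1) rels.
  by move=> relsK; rewrite all_cat relsK /= eqxx.
have relsN :
    all (fun e => term_val (subg N32 x32) (subg N32 y32) 1 e == 1) N_rels.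
  apply: sub_all N32_rels => e /eqP e1; apply/eqP/val_inj => /=.
  by rewrite (@term_val_morph _ _ sgval) // !subgK ?x32_N ?y32_N.
have [h [hx hy ht]] := pres_of_hom (ext _ _ _ relsN).
have [k [kx ky kt]] := pres_of_hom (ext _ _ _ relsH).
have := pres_of_rels rels; rewrite all_cat => /andP[relsA /andP[/eqP /= t1 _]].
have t2 : pgen rels 3 ^+ 2 = 1 by rewrite t1 expg1n.
have [l sz_l lP] := N_bound t2 relsA.
have h_bij : bijective h.
  apply: (@bij_of_bound _ _ _ l) => [g||p].
  - have [w ->] := pres_of_word g t2.
    (* The bound concerns words in $x,y$ alone, so the letters [st], whose value is 1, are
       deleted. *)
    suff -> : word_val (pgen rels 1) (pgen rels 2) (pgen rels 3) w
       = word_val (pgen rels 1) (pgen rels 2) (pgen rels 3)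
           [seq s <- w | s != st].
      by apply: lP => s; rewrite mem_filter; case: s.
    by elim: w => //= s w ->; case: s => //=; rewrite t1 mul1g.
  - by rewrite sz_l card_subg_of (leq_trans _ N32_order).
  by apply: (@gen2_surj _ _ _ _ _ (pgen rels 1) (pgen rels 2));
     rewrite ?hx ?hy subgK ?x32_N ?y32_N.
have [h' hK h'K] := h_bij.
have fM : {morph k \o h' : p q / p * q}.
  by move=> p q /=; rewrite -gmulfM -{1}(h'K p) -{1}(h'K q) -gmulfM hK.
pose f : {multiplicative subg_of N32 -> H} :=
  HB.pack (k \o h') (isMultiplicative.Build _ _ _ fM).
by exists f; split=> /=; rewrite -?hx -?hy hK.
Qed.

(** * The progenitor *)

(** Relators free of $t$ can be verified in [N32] with $t=1$ and then used with any value of $t$. *)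
Fixpoint no_t (e : term) : bool :=
  match e with
  | Tx | Ty => true
  | Tt => false
  | Tmul e1 e2 => no_t e1 && no_t e2
  | Tinv e1 | Texp e1 _ => no_t e1
  end.

Lemma term_val_no_t (G : groupType) (x y t u : G) e :
  no_t e -> term_val x y t e = term_val x y u e.
Proof.
by elim: e => //= [e1 IH1 e2 IH2 /andP[/IH1-> /IH2->] | e1 IH1 /IH1->
  | e1 IH1 n /IH1->].
Qed.

Lemma rels_no_t (G : groupType) (x y t u : G) rels :
    all no_t rels -> all (fun e => term_val x y t e == 1) rels ->
  all (fun e => term_val x y u e == 1) rels.
Proof.
elim: rels => //= e rels IHr /andP[e_t r_t] /andP[e1 r1].
by rewrite (term_val_no_t x y u t e_t) e1 IHr.
Qed.

Local Notation subx := (subg N32 x32).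
Local Notation suby := (subg N32 y32).

Lemma subg_term_val e :
  subg N32 (term_val x32 y32 1 e) = term_val subx suby 1 e.
Proof.
by rewrite -[RHS]sgvalK (@term_val_morph _ _ sgval) // !subgK ?x32_N ?y32_N.
Qed.

Lemma sd_inlM (H K : groupType) (to : Defs.aut_action H K) :
  {morph sd_inl to : k l / k * l}.
Proof. by move=> k l; congr pair; rewrite /= aut_act_one mulg1. Qed.

Lemma sd_inrM (H K : groupType) (to : Defs.aut_action H K) :
  {morph sd_inr to : a b / a * b}.
Proof. by move=> a b; congr pair; rewrite /= ?mulg1 ?aut_act1. Qed.

Lemma sd_split (H K : groupType) (to : Defs.aut_action H K) (g : semidirect to) :
  g = sd_inl to g.1 * sd_inr to g.2.
Proof. by case: g => k a; congr pair; rewrite /= ?mulg1 // aut_act_one mul1g. Qed.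

(** [prog_perm] accepts every permutation but respects products only on [N32]; on the subgroup type
    the map is a true morphism. *)
Definition calG_perm (k : subg_of N32) : calG :=
  quot_proj G_rels (sd_inl (star_action N32) k).

Lemma calG_permM : {morph calG_perm : k l / k * l}.
Proof. by move=> k l; rewrite /calG_perm sd_inlM quot_projM. Qed.

Lemma calG_permE e :
  quot_proj G_rels (prog_perm N32 (term_val x32 y32 1 e)) = term_val G_x G_y 1 e.
Proof.
rewrite /prog_perm subg_term_val -/(calG_perm _).
by rewrite (term_val_morph _ _ _ _ calG_permM).
Qed.

Lemma G_rels1 r : r \in G_rels -> quot_proj G_rels r = 1.
Proof.
move=> r_in; apply/esym/quot_projP; rewrite invg1 mul1g.
exact: normal_closure_gen.
Qed.

Definition calG_t (i : 'I_32) : calG := quot_proj G_rels (prog_gen N32 i).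

Lemma calG_tJ i p : p \in N32 ->
  calG_t i ^ quot_proj G_rels (prog_perm N32 p) = calG_t (p i).
Proof.
move=> Np; rewrite /calG_t -prog_genJ // /conjg !quot_projM.
by rewrite (morph_inv _ (@quot_projM _ _)).
Qed.

Lemma calG_t2 i : calG_t i ^+ 2 = 1.
Proof.
rewrite expgS expg1 /calG_t /prog_gen -quot_projM -sd_inrM.
by have -> : star_gen i * star_gen i = 1 by rewrite -[1](star_gen2 i) expgS expg1.
Qed.

Lemma point_tab p k m :
    (0 < k <= 32)%N -> (0 < m <= 32)%N -> nth 0 (ptab p) k.-1 = m.-1 ->
  p (point 31 k) = point 31 m.
Proof.
case: k m => [|k] [|m] // le_k le_m E; apply: val_inj.
by rewrite -nth_ptab /= !inordK.
Qed.

Lemma all_calG_rels (G : groupType) (x y t : G) :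
  all (fun e => term_val x y t e == 1) calG_rels =
  [&& all (fun e => term_val x y t e == 1) N_rels, t ^+ 2 == 1,
      [~ t, x ^+ 2] == 1, [~ t, y ^+ 2] == 1,
      (x * y ^- 2 * x * y * t ^ x) ^+ 6 == 1 &
      (x ^+ 5 * y ^+ 3 * t) ^+ 3 == 1].
Proof. by rewrite !all_cat /= !andbT -!andbA. Qed.

(** The relators of $N$ come from [N32]. The commutators vanish because $x^2$ and $y^2$ fix the
    point 1. As $x$ sends 1 to 2, $t_1^x=t_2$, which turns the last two relators into the defining
    ones. *)
Lemma calG_relsP : all (fun e => term_val G_x G_y G_t1 e == 1) calG_rels.
Proof.
have relsN : all (fun e => term_val G_x G_y G_t1 e == 1) N_rels.
  apply: (@rels_no_t _ _ _ 1) => //; apply: sub_all N32_rels => e /eqP e1.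
  by rewrite -calG_permE e1 -[1]/(term_val x32 y32 1 (Texp Tx 0)) calG_permE.
have fixp e : no_t e -> term_val x32 y32 1 e \in N32 ->
    nth 0 (word_tab 31 N_tab (term_word e)) 0 = 0 ->
    [~ G_t1, term_val G_x G_y G_t1 e] = 1.
  move=> e_t Ne e1; rewrite (term_val_no_t _ _ _ 1 e_t) -calG_permE /commg.
  rewrite -[G_t1]/(calG_t (point 31 1)) calG_tJ // (@point_tab _ 1 1) ?mulVg //.
  by rewrite -(@word_val_term _ _ _ 1) ?expg1n // (ptab_word N_tabE).
have permX : quot_proj G_rels (prog_perm N32 pi32)
    = G_x * G_y ^- 2 * G_x * G_y.
  exact: (calG_permE (Tx * Ty ^- 2 * Tx * Ty)%T).
have permT : quot_proj G_rels (prog_perm N32 tau32) = G_x ^+ 5 * G_y ^+ 3.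
  exact: (calG_permE (Tx ^+ 5 * Ty ^+ 3)%T).
have G_t2E : G_t1 ^ G_x = quot_proj G_rels (t32 2).
  rewrite -[G_t1]/(calG_t (point 31 1)) (calG_tJ _ x32_N).
  by rewrite (@point_tab _ 1 2) // ptab_x32.
have projX (r : prog32) n : quot_proj G_rels (r ^+ n) = quot_proj G_rels r ^+ n.
  elim: n => [//|n IHn]; by rewrite !expgS quot_projM IHn.
rewrite all_calG_rels relsN andTb; apply/and5P; split.
- by apply/eqP/(calG_t2 (point 31 1)).
- by apply/eqP/(fixp (Texp Tx 2)); rewrite // groupX ?x32_N.
- by apply/eqP/(fixp (Texp Ty 2)); rewrite // groupX ?y32_N.
- rewrite G_t2E -permX -quot_projM -projX; apply/eqP/G_rels1.
  by rewrite !inE eqxx orbT.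
rewrite -permT -[G_t1]/(quot_proj G_rels (t32 1)) -quot_projM -projX.
by apply/eqP/G_rels1; rewrite !inE eqxx.
Qed.

(** A transversal for the stabiliser of the point 1 in $N$: it makes each $t_i$ an explicit
    conjugate of $t_1$. *)
Definition point_words : seq (seq sym) := [::
    [::]; [:: sx]; [:: sy]; [:: sx; sy]; [:: sy; sx]; [:: sx; sy; sx];
    [:: sy; sx; sx]; [:: sy; sx; sy]; [:: sx; sy; sx; sx];
    [:: sx; sy; sx; sy]; [:: sx; sy; sX; sX]; [:: sx; sy; sX; sY];
    [:: sy; sx; sy; sx]; [:: sy; sX; sX]; [:: sy; sX; sY];
    [:: sx; sy; sx; sy; sx]; [:: sx; sy; sX]; [:: sy; sx; sy; sX];
    [:: sy; sX; sy; sX]; [:: sy; sx; sy; sx; sx]; [:: sx; sy; sX; sY; sX];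
    [:: sy; sX]; [:: sy; sx; sx; sY]; [:: sy; sX; sY; sx];
    [:: sx; sy; sx; sy; sx; sx]; [:: sy; sX; sY; sX]; [:: sx; sy; sX; sy];
    [:: sy; sX; sy]; [:: sy; sx; sx; sY; sX]; [:: sy; sx; sy; sX; sX];
    [:: sx; sy; sX; sy; sx]; [:: sy; sX; sy; sx]].

Lemma point_wordsP (i : 'I_32) :
  word_val x32 y32 1 (nth [::] point_words i) (point 31 1) = i.
Proof.
apply: val_inj; rewrite (val_word N_tabE) [val (point _ _)]inordK //.
have /allP/(_ (val i)) :
    all (fun k => act_word N_tab (nth [::] point_words k) 0 == k) (iota 0 32).
  by vm_compute.
by rewrite mem_iota => /(_ (ltn_ord i))/eqP.
Qed.

Lemma calG_word (g : calG) : exists w, g = word_val G_x G_y G_t1 w.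
Proof.
pose W (h : calG) := exists w, h = word_val G_x G_y G_t1 w.
have WM h k : W h -> W k -> W (h * k).
  by case=> u -> [v ->]; exists (u ++ v); rewrite word_val_cat.
have W1 : W 1 by exists [::].
have WV h : W h -> W h^-1.
  by case=> u ->; exists (symsV u); rewrite word_valV //; apply: calG_t2.
have Wperm p : p \in N32 -> W (quot_proj G_rels (prog_perm N32 p)).
  (* Membership is carried through the induction, since [subgM] needs it for both factors. *)
  suff: p \in N32 -> p \in N32 /\ W (quot_proj G_rels (prog_perm N32 p)).
    by move=> Np /Np[].
  move: p; apply: gen2_ind => [|p q [Np Wp] [Nq Wq]||].
  - by split; [exact: group1 | rewrite (calG_permE (Texp Tx 0))].
  - split; first exact: groupM.
    by rewrite /prog_perm subgM // sd_inlM quot_projM; apply: WM.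
  - by split; [exact: x32_N | exists [:: sx]; rewrite /= mulg1].
  by split; [exact: y32_N | exists [:: sy]; rewrite /= mulg1].
have Wt i : W (calG_t i).
  have Np := mem_word_val (nth [::] point_words i) x32_N y32_N (group1 N32).
  rewrite -(point_wordsP i) -calG_tJ // /conjg.
  apply: (WM _ _ (WV _ (Wperm _ Np))).
  by apply: WM; [exists [:: st]; rewrite /= mulg1 | exact: Wperm].
have Wstar a : W (quot_proj G_rels (sd_inr (star_action N32) a)).
  rewrite -(quot_repr a) -(free_repr (generic_quotient.repr a)).
  elim: (generic_quotient.repr _) => [|[i b] u IHu]; first exact: W1.
  rewrite -cat1s free_class_cat quot_projM sd_inrM quot_projM.
  apply: WM IHu; case: b; last exact: Wt.
  suff -> : quot_proj (star_rels _) (free_class [:: (i, true)]) = (star_gen i)^-1.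
    rewrite (morph_inv _ (@sd_inrM _ _ _)) (morph_inv _ (@quot_projM _ _)).
    exact/WV/Wt.
  rewrite -[RHS]/(quot_inv (quot_proj _ (free_gen i))) quot_invE.
  by congr quot_proj; rewrite -[RHS]free_classV.
change (W g); rewrite -(quot_repr g) (sd_split (generic_quotient.repr g)).
rewrite quot_projM.
apply: WM => //; rewrite -[_.1]sgvalK; apply: Wperm; exact: subgP.
Qed.

(** A morphism from the semidirect product is a pair of morphisms, [k] on $N$ and [r] on the free
    product, such that [r] turns the action of $N$ into conjugation through [k]. This compatibility
    is checked on the $t_i$ and for $x,y$ only. The whole family [u] is given as data: recovering it
    from its value at the point 1 would require knowing that $x^2$ and $y^2$ generate the stabiliser
    of that point. *)
Lemma calG_hom (H : groupType) (a b : H) (u : 'I_32 -> H) :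
    all (fun e => term_val a b (u (point 31 1)) e == 1) calG_rels ->
    (forall i, u (x32 i) = u i ^ a) -> (forall i, u (y32 i) = u i ^ b) ->
  exists f : {multiplicative calG -> H},
    [/\ f G_x = a, f G_y = b & f G_t1 = u (point 31 1)].
Proof.
rewrite all_calG_rels => /and5P[relsN /eqP t2 _ _ /andP[/eqP rel_pi /eqP rel_tau]].
move=> ua ub.
have [k [kx ky]] : exists k : {multiplicative subg_of N32 -> H},
    k subx = a /\ k suby = b.
  by apply: N32_hom; apply: rels_no_t relsN.
have kE e : k (subg N32 (term_val x32 y32 1 e)) = term_val a b 1 e.
  rewrite subg_term_val (term_val_morph _ _ _ _ (@gmulfM _ _ k)) kx ky.
  by rewrite (morph_one (@gmulfM _ _ k)).
have uJ p i : p \in N32 -> u (p i) = u i ^ k (subg N32 p).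
  suff: p \in N32 -> p \in N32 /\ forall i, u (p i) = u i ^ k (subg N32 p).
    by move=> Np /Np[].
  move: p {i}; apply: gen2_ind => [|p q [Np up] [Nq uq]||].
  - split=> [|i]; first exact: group1.
    by rewrite perm1 (kE (Texp Tx 0)) conjg1.
  - split=> [|i]; first exact: groupM.
    by rewrite permM uq up subgM // gmulfM conjgM.
  - by split=> [|i]; [exact: x32_N | rewrite kx].
  by split=> [|i]; [exact: y32_N | rewrite ky].
have u2 i : u i ^+ 2 = 1.
  have Np := mem_word_val (nth [::] point_words i) x32_N y32_N (group1 N32).
  rewrite -(point_wordsP i) uJ // expgS expg1 -conjMg.
  by rewrite -[_ * _]/(_ ^+ 2) t2 conj1g.
have u1 r : r \in star_rels 'I_32 -> free_lift u r = 1.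
  case/mapP=> i _ ->; rewrite expgS expg1 free_liftM free_lift_gen.
  by rewrite -[_ * _]/(_ ^+ 2) u2.
pose r := quot_lift (rs := star_rels 'I_32) (free_lift u).
have rM : {morph r : c d / c * d} := quot_liftM (free_liftM u) u1.
have rE i : r (star_gen i) = u i.
  by rewrite /r quot_liftE ?free_lift_gen //; apply: free_liftM.
have rJ c n : r (star_action N32 c n) = r c ^ k n.
  move: c; apply: (@pres_ext _ _ _ (fun c => r (star_action N32 c n))
    (fun c => r c ^ k n)) => [c d|c d|i].
  - by rewrite aut_actM rM.
  - by rewrite rM conjMg.
  rewrite -/(star_gen i) rE -[star_action _ _ _]/(star_act _ _) star_act_gen rE.
  by rewrite uJ ?subgP // sgvalK.
pose h (g : prog32) := k g.1 * r g.2.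
have hM : {morph h : g1 g2 / g1 * g2}.
  move=> [n1 c1] [n2 c2]; rewrite /h /= gmulfM rM rJ /conjg.
  by rewrite -!mulgA mulKVg.
have h_perm e : h (prog_perm N32 (term_val x32 y32 1 e)) = term_val a b 1 e.
  by rewrite /h /= kE (morph_one rM) mulg1.
have h_t i : h (prog_gen N32 i) = u i.
  by rewrite /h /= rE (morph_one (@gmulfM _ _ k)) mul1g.
have hX g n : h (g ^+ n) = h g ^+ n.
  by elim: n => [|n IHn]; [exact: morph_one | rewrite !expgS hM IHn].
have h1 g : g \in G_rels -> h g = 1.
  rewrite !inE => /orP[] /eqP->; rewrite hX hM h_t.
    by rewrite (h_perm (Tx ^+ 5 * Ty ^+ 3)%T).
  rewrite (h_perm (Tx * Ty ^- 2 * Tx * Ty)%T) -[RHS]rel_pi -ua.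
  by rewrite (@point_tab _ 1 2) // ptab_x32.
have fM := quot_liftM hM h1.
pose f : {multiplicative calG -> H} :=
  HB.pack (quot_lift h) (isMultiplicative.Build _ _ _ fM).
exists f; split; rewrite /f /= /G_x /G_y /G_t1 (quot_liftE hM h1).
- exact: (h_perm Tx).
- exact: (h_perm Ty).
exact: h_t.
Qed.

(** * Isomorphisms onto $J_2$ *)

Local Notation subX := (subg J2 J2x).
Local Notation subY := (subg J2 J2y).
Local Notation subT := (subg J2 J2t).

Lemma J2_subg_rels rels :
    all (fun e => term_val J2x J2y J2t e == 1) rels ->
  all (fun e => term_val subX subY subT e == 1) rels.
Proof.
have [Jx Jy Jt] := J2xyt_in.
apply: sub_all => e /eqP e1; apply/eqP/val_inj => /=.
by rewrite (@term_val_morph _ _ sgval) // !subgK.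
Qed.

(** The order bound from the enumeration meets the lower bound for [J2], and surjectivity follows
    from the words for [J2a] and [J2b]. The statement serves [presG] and [calG] alike. *)
Lemma J2_bij (G : groupType) (x y t : G) rels steps
    (f : {multiplicative G -> subg_of J2}) :
    all (fun e => term_val x y t e == 1) (N_rels ++ rels) -> t ^+ 2 = 1 ->
    coset_count (map term_word (N_rels ++ rels)) [:: sx; sy]
      [:: sx; sX; sy; sY; st] steps = 315 ->
    (forall g, exists w, g = word_val x y t w) ->
    f x = subX -> f y = subY -> f t = subT ->
  bijective f.
Proof.
move=> rels1 t2 count words fx fy ft; have [Jx Jy Jt] := J2xyt_in.
have [l sz_l lP] := G_bound t2 rels1 count.
apply: (@bij_of_bound _ _ _ l) => [g||].
- by have [w ->] := words g.
- rewrite sz_l card_subg_of; apply: leq_trans J2_order.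
  (* The factors $10\cdot192\cdot315$ are rearranged into $100\cdot63\cdot96$ symbolically, so that
     $604800$ is never expanded as a unary number. *)
  have regroup k m : (10 * (2 * m) * (5 * k) = 100 * k * m)%N.
    by rewrite (mulnA 10) mulnACA (mulnC m) (mulnA _ k).
  by rewrite -(mulnA (100 * 63)%N) -[(12 * 8)%N]/96 -regroup; apply: leqnn.
have fw w : sgval (f (word_val x y t w)) = word_val J2x J2y J2t w.
  elim: w => [|s w IHw] /=; first by rewrite (morph_one (@gmulfM _ _ f)).
  rewrite gmulfM /= IHw; congr (_ * _).
  by case: s; rewrite /= ?(morph_inv _ (@gmulfM _ _ f)) ?fx ?fy ?ft /= subgK.
exact: gen2_surj (etrans (fw _) (esym J2aE)) (etrans (fw _) (esym J2bE)).
Qed.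

Definition t_word (k : nat) : seq sym :=
  let w := nth [::] point_words k in symsV w ++ st :: w.

Definition J2_t (i : 'I_32) : subg_of J2 :=
  subg J2 (word_val J2x J2y J2t (t_word i)).

(** The compatibility needed by [calG_hom], reduced to comparing permutation tables for the 32
    conjugates of [J2t]. *)
Lemma J2_tJ (p : 'S_32) s :
    all (fun k => word_tab 99 J2_tab (t_word (nth 0 (ptab p) k))
                == word_tab 99 J2_tab (symV s :: t_word k ++ [:: s])) (iota 0 32) ->
  forall i, J2_t (p i) = J2_t i ^ subg J2 (sym_val J2x J2y J2t s).
Proof.
have [Jx Jy Jt] := J2xyt_in.
move=> /allP tab_p i; apply: val_inj.
have Js : sym_val J2x J2y J2t s \in J2 by case: s {tab_p} => /=; rewrite ?groupV.
have Jw : word_val J2x J2y J2t (t_word i) \in J2 by apply: mem_word_val.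
rewrite /= !subgK //; last exact: mem_word_val.
have /tab_p/eqP : val i \in iota 0 32 by rewrite mem_iota ltn_ord.
rewrite nth_ptab -!(ptab_word J2_tabE) => /ptab_inj ->.
by rewrite /= word_val_cat (sym_valV _ _ J2t_2) /= mulg1.
Qed.

Theorem theorem1 :
  (exists f : {multiplicative presG -> calG},
     [/\ bijective f, f presG_x = G_x, f presG_y = G_y & f presG_t = G_t1]) /\
  isomorphic calG (subg_of J2).
Proof.
have [p [px py pt]] := pres_of_hom (J2_subg_rels J2_presG_rels).
have [c [cx cy ct]] : exists c : {multiplicative calG -> subg_of J2},
    [/\ c G_x = subX, c G_y = subY & c G_t1 = subT].
  have tE : J2_t (point 31 1) = subT.
    by rewrite /J2_t /= inordK //= mulg1.
  rewrite -tE; apply: calG_hom.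
  - by rewrite tE; apply/J2_subg_rels/J2_calG_rels.
  - by apply: (@J2_tJ _ sx); rewrite ptab_x32; vm_compute.
  by apply: (@J2_tJ _ sy); rewrite ptab_y32; vm_compute.
have c_bij : bijective c.
  apply: (J2_bij calG_relsP (calG_t2 _) calG_count calG_word cx cy ct).
have p_bij : bijective p.
  have rels := pres_of_rels presG_rels.
  have t2 : pgen presG_rels 3 ^+ 2 = 1.
    by move: rels; rewrite !all_cat /= => /and3P[_ /and5P[/eqP ]].
  by apply: (J2_bij rels t2 presG_count _ px py pt) => g; apply: pres_of_word.
split; last by exists c.
have [c' cK c'K] := c_bij.
have fM : {morph c' \o p : a b / a * b}.
  by move=> a b; apply: (bij_inj c_bij); rewrite gmulfM /= !c'K gmulfM.
pose f : {multiplicative presG -> calG} :=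
  HB.pack (c' \o p : presG -> calG) (isMultiplicative.Build _ _ _ fM).
exists f; split.
- by apply: bij_comp p_bij; exists c.
- by rewrite -[LHS]/(c' (p (pgen _ 1))) px -cx cK.
- by rewrite -[LHS]/(c' (p (pgen _ 2))) py -cy cK.
by rewrite -[LHS]/(c' (p (pgen _ 3))) pt -ct cK.
Qed.
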